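(* Let $G_1,G_2$ be non-isomorphic finite connected graphs, neither of which is a single vertex, with $\{G_1,G_2\}\neq\{P_1,P_2\}$ and $\{G_1,G_2\}\neq\{P_1,P_3\}$ (as unordered pairs up to isomorphism). Then there exists a connected graph $H$, isomorphic to neither $G_1$ nor $G_2$, such that $H$ has exactly one decomposition $(H_1,H_2)$ into $G_1,G_2$, i.e. $(G_1,G_2,H)$ is uniquely decomposable.
   Context: $P_i$ denotes the path with $i$ edges. A \emph{decomposition} of a connected graph $H$ into $G_1,G_2$ is a pair $(H_1,H_2)$ of subgraphs of $H$ with $H_1\cong G_1$, $H_2\cong G_2$, $V(H_1)\cup V(H_2)=V(H)$ and $E(H_1)\cup E(H_2)=E(H)$. $(G_1,G_2,H)$ is \emph{uniquely decomposable} if exactly one such pair exists. *)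

(* Defs.v *)
From mathcomp Require Import all_boot.
Set Implicit Arguments. Unset Strict Implicit. Unset Printing Implicit Defensive.

Definition simple_graph (V : finType) (e : rel V) : Prop :=
  symmetric e /\ irreflexive e.

Definition connected_graph (V : finType) (e : rel V) : Prop :=
  0 < #|V| /\ forall x y : V, connect e x y.

Definition graph_iso (V W : finType) (eV : rel V) (eW : rel W) : Prop :=
  exists f : V -> W, bijective f /\ forall x y, eW (f x) (f y) = eV x y.

(* The path P_i with i edges, on vertices 0..i. *)
Definition path_rel (i : nat) : rel 'I_i.+1 :=
  fun x y => (x.+1 == y :> nat) || (y.+1 == x :> nat).
Arguments path_rel i : clear implicits.

(* A subgraph of (V,e): a vertex set together with a symmetric edge set
   (edges stored as both ordered pairs). *)
Definition subgraph (V : finType) := ({set V} * {set V * V})%type.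

Definition is_subgraph (V : finType) (e : rel V) (A : subgraph V) : Prop :=
  forall p, p \in A.2 -> [/\ p.1 \in A.1, p.2 \in A.1, e p.1 p.2 & (p.2, p.1) \in A.2].

Definition sub_iso (V W : finType) (A : subgraph V) (eW : rel W) : Prop :=
  exists f : W -> V, [/\ injective f, f @: [set: W] = A.1 &
                        forall x y, eW x y = ((f x, f y) \in A.2)].

Definition is_decomposition (V W1 W2 : finType) (e : rel V) (e1 : rel W1) (e2 : rel W2)
  (d : subgraph V * subgraph V) : Prop :=
  is_subgraph e d.1 /\ is_subgraph e d.2 /\ sub_iso d.1 e1 /\ sub_iso d.2 e2 /\
  d.1.1 :|: d.2.1 = [set: V] /\
  d.1.2 :|: d.2.2 = [set p : V * V | e p.1 p.2].

Definition uniquely_decomposable (V W1 W2 : finType) (e : rel V) (e1 : rel W1) (e2 : rel W2)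
  : Prop :=
  exists d, is_decomposition e e1 e2 d /\
    forall d', is_decomposition e e1 e2 d' -> d' = d.

(* Main.v *)
Require Import Defs.
From mathcomp Require Import all_boot zify.
From Stdlib Require Import Classical.
Set Implicit Arguments. Unset Strict Implicit. Unset Printing Implicit Defensive.

(** Let G2 have at most as many vertices as G1. If H arises from gluing a vertex q of G1 to a
    vertex v of G2, then by counting vertices the two parts of any decomposition of H meet in a
    single vertex.

    If G2 has at least three vertices, take q to be an end of a diametral pair (p, q) of G1. A
    second decomposition would have to remove a copy of G2 that hangs at a vertex w of G1,
    contains p and misses q: otherwise the part isomorphic to G1 would have a larger diameter.
    The root w does not depend on v, whereas counting non-cut vertices shows that the number of
    branches at w depends on whether v is a cut vertex of G2. So if every such gluing fails, then G2 has
    no cut vertex and hangs at both ends of the pair (p, q). In this case glue two vertices of G2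
    to q and to a neighbour r of q in the copy of G2 at that end, again so as to increase the
    diameter. A second decomposition would remove the copy of G2 at the other end p, but would
    leave one of its vertices as a new leaf.

    If G2 is a single edge, attach it at a vertex of maximal degree without leaf neighbours, or at a leaf
    whose distance to the vertices of degree at least 3 is maximal. Neither exists exactly when
    G1 is a path with two or three edges. *)

(** * Connected sets and 1-sums *)

Section Conn.
Variables (V : finType) (e : rel V).
Implicit Types (X Y P D : {set V}) (x y z : V).

(* Connectedness of the induced subgraph, stated through closed sets P instead of paths: a side of
   a separation can then be used directly as P. *)
Definition conn X : bool :=
  [forall P : {set V}, [exists x in X, x \in P] ==>
     [forall x in X, forall y in X, (x \in P) && e x y ==> (y \in P)] ==> (X \subset P)].

Lemma connP X :
  reflect (forall P x0, x0 \in X -> x0 \in P ->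
             (forall x y, x \in X -> y \in X -> x \in P -> e x y -> y \in P) ->
             X \subset P)
          (conn X).
Proof.
apply: (iffP forallP) => [cX P x0 x0X x0P clP | cX P].
  have /implyP/(_ _)/implyP := cX P; apply.
    by apply/existsP; exists x0; rewrite x0X.
  apply/forall_inP => x xX; apply/forall_inP => y yX.
  by apply/implyP => /andP[xP xy]; apply: clP xX yX xP xy.
apply/implyP => /existsP[x0 /andP[x0X x0P]]; apply/implyP => /forall_inP clP.
apply: (cX P x0) => // x y xX yX xP xy.
by have /forall_inP/(_ y yX)/implyP := clP x xX; apply; rewrite xP.
Qed.

(** Take [D] itself as the closed set. Below, [D] is typically a part of a decomposition or a
    pendant copy, and [X] a connected set avoiding the separating vertex. *)
Lemma conn_side X D :
  conn X -> (forall x y, x \in X -> y \in X -> x \in D -> y \notin D -> ~~ e x y) ->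
  (X \subset D) \/ (forall x, x \in X -> x \notin D).
Proof.
move=> cX nc; case: (boolP [exists x in X, x \in D]) => [/existsP[x0 /andP[x0X x0D]]|].
  left; apply: (connP _ cX _ x0) => // x y xX yX xD xy.
  by apply: contraTT xy => yD; apply: nc.
rewrite negb_exists => /forallP nD; right => x xX.
by have := nD x; rewrite xX.
Qed.

Lemma connU X Y z : symmetric e ->
  conn X -> conn Y -> z \in X -> z \in Y -> conn (X :|: Y).
Proof.
move=> se cX cY zX zY; apply/connP => P x0 x0U x0P clP.
have half (A B : {set V}) : A :|: B = X :|: Y -> conn A -> conn B ->
    z \in A -> z \in B -> x0 \in A -> A :|: B \subset P.
  move=> eU cA cB zA zB x0A.
  have AP : A \subset P.
    apply: (connP _ cA _ x0) => // x y xA yA; apply: clP; rewrite -eU inE ?xA ?yA //.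
  rewrite subUset AP; apply: (connP _ cB _ z) => //; first exact: (subsetP AP).
  by move=> x y xB yB; apply: clP; rewrite -eU inE ?xB ?yB orbT.
case/setUP: (x0U) => x0A; first exact: (half X Y).
by rewrite setUC; apply: (half Y X) => //; rewrite setUC.
Qed.

Lemma conn1 x : conn [set x].
Proof. by apply/connP => P y /set1P-> xP _; rewrite sub1set. Qed.

Lemma connU1 X x y : symmetric e -> conn X -> x \in X -> e x y -> conn (y |: X).
Proof.
move=> se cX xX xy; have cxy : conn [set y; x].
  apply/connP => P z; rewrite !inE => zz zP cl; apply/subsetP => t.
  have [yP xP] : y \in P /\ x \in P.
    case/orP: zz zP => /eqP-> zP; split=> //.
      by apply: (cl y x); rewrite ?inE ?eqxx ?orbT // se.
    by apply: (cl x y); rewrite ?inE ?eqxx ?orbT.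
  by rewrite !inE => /orP[] /eqP->.
have -> : y |: X = [set y; x] :|: X by apply/setP => t; rewrite !inE; case: eqP => //= _; case: eqP => //= ->; rewrite xX.
by apply: (@connU _ _ x) => //; rewrite !inE eqxx orbT.
Qed.

Lemma conn_nbr X x y : conn X -> x \in X -> y \in X -> x != y ->
  exists2 z, z \in X & (z != x) && e x z.
Proof.
move=> cX xX yX xy; case: (pickP [pred z in X | (z != x) && e x z]) => [z /andP[zX zz]|no].
  by exists z.
have /subsetP/(_ y yX) : X \subset [set x].
  apply: (connP _ cX _ x) => //; first by rewrite inE.
  move=> a b aX bX /set1P-> xb; have := no b; rewrite inE bX xb andbT /= => /negbFE/eqP->.
  by rewrite inE.
by rewrite inE eq_sym (negPf xy).
Qed.

Lemma noncut_exists X r : symmetric e -> conn X -> r \in X -> 1 < #|X| ->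
  exists x, [/\ x \in X, x != r & conn (X :\ x)].
Proof.
move=> se cX rX X1.
(* A maximal connected proper subset containing r misses exactly one vertex. *)
have P1 : [&& conn [set r], r \in [set r] & [set r] \proper X].
  rewrite conn1 inE eqxx properE sub1set rX /=.
  apply: contraL X1 => sX; rewrite -leqNgt -(cards1 r); exact: subset_leq_card.
have [Y /maxsetP[/and3P[cY rY pY] mY] _] :=
  @maxset_exists _ (fun Y => [&& conn Y, r \in Y & Y \proper X]) _ P1.
have [sY nY] := andP pY.
case: (pickP [pred ab : V * V | [&& ab.1 \in Y, ab.2 \in X, ab.2 \notin Y & e ab.1 ab.2]])
    => [[a b] /= /and4P[aY bX bY ab]|no]; last first.
  case/negP: nY; apply: (connP _ cX _ r) => // x y xX yX xY xy.
  by have := no (x, y); rewrite /= xY yX xy andbT /= => /negbFE.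
exists b; split=> //; first by apply: contraNneq bY => ->.
have sbY : b |: Y \subset X by rewrite subUset sub1set bX.
have [pb|npb] := boolP (b |: Y \proper X).
  have /mY : [&& conn (b |: Y), r \in b |: Y & b |: Y \proper X].
    by apply/and3P; split; rewrite ?inE ?rY ?orbT //; apply: (connU1 se cY aY ab).
  by move/(_ (subsetUr _ _)) => E; rewrite -E !inE eqxx in bY.
have -> : X = b |: Y by apply/eqP; rewrite eqEsubset sbY; rewrite properE sbY negbK in npb; rewrite npb.
by rewrite setU1K.
Qed.
End Conn.

Lemma conn_im (V W : finType) (eV : rel V) (eW : rel W) (f : W -> V) (Y : {set W}) :
  (forall x y, x \in Y -> y \in Y -> eW x y -> eV (f x) (f y)) ->
  conn eW Y -> conn eV (f @: Y).
Proof.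
move=> hf cY; apply/connP => P _ /imsetP[x0 x0Y ->] x0P clP.
have /subsetP sY : Y \subset f @^-1: P.
  apply: (connP _ _ cY _ x0) => //; first by rewrite inE.
  move=> x y xY yY; rewrite !inE => xP xy.
  by apply: (clP (f x)) => //; rewrite ?imset_f // hf.
by apply/subsetP => _ /imsetP[x xY ->]; have := sY x xY; rewrite inE.
Qed.

Lemma conn_im_eq (V W : finType) (eV : rel V) (eW : rel W) (f : W -> V) (Y : {set W}) :
  injective f -> (forall x y, x \in Y -> y \in Y -> eV (f x) (f y) = eW x y) ->
  conn eV (f @: Y) = conn eW Y.
Proof.
move=> fI hf; apply/idP/idP => [cY|]; last by apply: conn_im => x y xY yY; rewrite hf.
apply/connP => P x0 x0Y x0P clP.
have /subsetP sY : f @: Y \subset f @: P.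
  apply: (connP _ _ cY _ (f x0)); rewrite ?imset_f //.
  move=> _ _ /imsetP[x xY ->] /imsetP[y yY ->]; rewrite !mem_imset // hf //.
  exact: clP.
by apply/subsetP => x xY; have := sY _ (imset_f f xY); rewrite mem_imset.
Qed.

Lemma imsetD1 (V W : finType) (f : W -> V) (Y : {set W}) x :
  injective f -> f @: (Y :\ x) = f @: Y :\ f x.
Proof.
move=> fI; apply/setP => t; rewrite !inE; apply/imsetP/andP.
  by case=> a /setD1P[ax aY] ->; rewrite imset_f //; split=> //; apply: contraNneq ax => /fI ->.
case=> tx /imsetP[a aY ta]; exists a => //; rewrite !inE aY andbT.
by apply: contraNneq tx => <-; rewrite ta.
Qed.

Section OneSum.
Variables (V : finType) (e : rel V).
Hypothesis se : symmetric e.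
Implicit Types (X Y : {set V}).

(** Connectedness of the sides is left out, so that a side may lose a vertex and still form a
    1-sum. *)
Definition one_sum X Y c : Prop :=
  X :&: Y = [set c] /\
  forall x y, x \in X -> y \in Y -> x != c -> y != c -> ~~ e x y.

Lemma one_sumC X Y c : one_sum X Y c -> one_sum Y X c.
Proof.
case=> XY nc; split; first by rewrite setIC.
by move=> x y xY yX xc yc; rewrite se; apply: nc.
Qed.

(** A closed set [P] of [X] extends to a closed set of the union: [P :|: Y] if it contains [c], and
    [P :&: X] otherwise, since [X] can only be left through [c]. *)
Lemma one_sum_l X Y c : one_sum X Y c -> conn e (X :|: Y) -> conn e X.
Proof.
case=> XY nc cU; have /setIP[cX cY] : c \in X :&: Y by rewrite XY inE.
have eqc a : a \in X -> a \in Y -> a = c.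
  by move=> aX aY; apply/set1P; rewrite -XY inE aX.
have ncE x y : x \in X -> y \in Y -> e x y -> x = c \/ y = c.
  move=> xX yY xy; have := nc x y xX yY; rewrite xy.
  have [->|_] := eqVneq x c; first by left.
  by have [->|_ /(_ isT isT)] := eqVneq y c; first by right.
apply/connP => P x0 x0X x0P clP; apply/subsetP => a aX.
have [cP|cP] := boolP (c \in P).
  have /subsetP/(_ a) : X :|: Y \subset P :|: Y.
    apply: (connP _ _ cU _ x0); rewrite ?inE ?x0X ?x0P // => x y.
    rewrite !in_setU => xU /orP[yX|->]; last by rewrite orbT.
    move=> xPY xy; have [xX|xX] := boolP (x \in X).
      have [xP|xP] := boolP (x \in P); first by rewrite (clP x).
      by rewrite (negPf xP) /= in xPY; rewrite -(eqc x xX xPY) (negPf xP) in cP.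
    rewrite (negPf xX) /= in xU; rewrite se in xy.
    case: (ncE y x yX xU xy) => E; first by rewrite E cP.
    by rewrite E cX in xX.
  by rewrite !inE aX => /(_ isT)/orP[//|/(eqc a aX)->].
have /subsetP/(_ c) : X :|: Y \subset P :&: X.
  apply: (connP _ _ cU _ x0); rewrite ?inE ?x0X ?x0P // => x y.
  rewrite !in_setU !in_setI => _ yU /andP[xP xX] xy.
  have [yX|yX] := boolP (y \in X); first by rewrite andbT; apply: (clP x).
  rewrite (negPf yX) /= in yU; case: (ncE x y xX yU xy) => E.
    by rewrite -E xP in cP.
  by rewrite E cX in yX.
by rewrite !inE cX (negPf cP) => /(_ isT).
Qed.

Lemma one_sum_conn X Y c : one_sum X Y c -> conn e X -> conn e Y -> conn e (X :|: Y).
Proof.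
case=> XY nc; have /setIP[cX cY] : c \in X :&: Y by rewrite XY inE.
by move=> h1 h2; apply: connU h1 h2 cX cY.
Qed.

(** Deleting [z] leaves a 1-sum with the same [Y] and [c]. As [Y] is connected, this sum is
    connected exactly when its other side is. *)
Lemma one_sum_noncut X Y c z : one_sum X Y c -> conn e Y ->
  z \in X -> z != c -> conn e ((X :|: Y) :\ z) = conn e (X :\ z).
Proof.
move=> S cY zX zc; have [XY nc] := S.
have zY : z \notin Y by apply: contra zc => zY; rewrite -in_set1 -XY inE zX.
have -> : (X :|: Y) :\ z = (X :\ z) :|: Y.
  by apply/setP => t; rewrite !inE; case: eqP => // ->; rewrite (negPf zY).
have S' : one_sum (X :\ z) Y c.
  split=> [|x y /setD1P[_ xX]]; last exact: nc.
  apply/setP => t; rewrite -XY !inE; case: eqP => // ->; by rewrite (negPf zY) !andbF.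
by apply/idP/idP => [/(one_sum_l S')|cX]; last apply: (one_sum_conn S' cX cY).
Qed.

Lemma one_sum_cut X Y c x y : one_sum X Y c -> x \in X -> x != c -> y \in Y -> y != c ->
  ~~ conn e ((X :|: Y) :\ c).
Proof.
case=> XY nc xX xc yY yc; apply/negP => cU.
have /subsetP/(_ y) : (X :|: Y) :\ c \subset X.
  apply: (connP _ _ cU _ x); rewrite ?inE ?xc ?xX // => a b.
  rewrite !inE => /andP[ac _] /andP[bc /orP[//|bY]] aX ab.
  by have := nc a b aX bY ac bc; rewrite ab.
rewrite !inE yc yY orbT => /(_ isT) yX.
by have := in_set1 y c; rewrite -XY inE yX yY (negPf yc).
Qed.

Definition noncut X : {set V} := [set x in X | conn e (X :\ x)].

(** Gluing changes the status of [c] alone: it is a cut vertex of the sum, but may be non-cut in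
    either summand. The Booleans record this loss without subtraction. *)
Lemma one_sum_card_noncut X Y c x y : one_sum X Y c -> conn e X -> conn e Y ->
  x \in X -> x != c -> y \in Y -> y != c ->
  #|noncut (X :|: Y)| + (c \in noncut X) + (c \in noncut Y) = #|noncut X| + #|noncut Y|.
Proof.
move=> S cX cY xX xc yY yc; have [XY nc] := S.
have -> : noncut (X :|: Y) = (noncut X :\ c) :|: (noncut Y :\ c).
  apply/setP => t; rewrite !inE; have [->|tc] /= := eqVneq t c.
    by rewrite (negPf (one_sum_cut S xX xc yY yc)) andbF.
  have [tX|tX] := boolP (t \in X); have [tY|tY] := boolP (t \in Y) => //=.
  - by have := in_set1 t c; rewrite -XY inE tX tY (negPf tc).
  - by rewrite orbF (one_sum_noncut S).
  by rewrite setUC (one_sum_noncut (one_sumC S)).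
rewrite cardsU (_ : _ :&: _ = set0) ?cards0 ?subn0; last first.
  apply/setP => t; rewrite !inE; have [//|tc] /= := eqVneq t c.
  by have := in_set1 t c; rewrite -XY inE (negPf tc); case: (t \in X) => //= ->; rewrite andbF.
rewrite (cardsD1 c (noncut X)) (cardsD1 c (noncut Y)); lia.
Qed.
End OneSum.

Lemma card_noncut_im (V W : finType) (eV : rel V) (eW : rel W) (f : W -> V) (Y : {set W}) :
  injective f -> (forall x y, x \in Y -> y \in Y -> eV (f x) (f y) = eW x y) ->
  noncut eV (f @: Y) = f @: noncut eW Y.
Proof.
move=> fI hf; have E y : conn eV (f @: Y :\ f y) = conn eW (Y :\ y).
  rewrite -(conn_im_eq fI (eV := eV) (eW := eW)); last first.
    by move=> a b /setD1P[_ aY] /setD1P[_ bY]; apply: hf.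
  by rewrite imsetD1.
apply/setP => t; rewrite inE; apply/andP/imsetP.
  by case=> /imsetP[a aY ->]; rewrite E => c; exists a; rewrite // inE aY.
by case=> a; rewrite inE => /andP[aY c] ->; rewrite imset_f ?E.
Qed.

(** * Decompositions and amalgams *)

Lemma connected_conn (V : finType) (e : rel V) : connected_graph e -> conn e setT.
Proof.
case=> _ cV; apply/connP => P x0 _ x0P clP; apply/subsetP => y _.
have /connectP[s] := cV x0 y; elim: s x0 x0P => [|z s IH] x xP /=; first by move=> _ ->.
by case/andP=> xz ps; apply: IH => //; apply: (clP x); rewrite ?inE.
Qed.

Lemma conn_connected (V : finType) (e : rel V) :
  0 < #|V| -> conn e setT -> connected_graph e.
Proof.
move=> V0 cV; split=> // x y.
have /subsetP/(_ y) : [set: V] \subset [set z | connect e x z].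
  apply: (connP _ _ cV _ x); rewrite ?inE ?connect0 // => a b _ _.
  rewrite !inE => xa ab; exact: connect_trans xa (connect1 ab).
by rewrite !inE; apply.
Qed.

Lemma graph_iso_card (V W : finType) (eV : rel V) (eW : rel W) :
  graph_iso eV eW -> #|V| = #|W|.
Proof. by case=> f [fb _]; apply: bij_eq_card fb. Qed.

Notation im f := (f @: [set: _]).

Definition edges (V W : finType) (eW : rel W) (f : W -> V) : {set V * V} :=
  [set (f p.1, f p.2) | p in [set p : W * W | eW p.1 p.2]].

Section Edges.
Variables (V W : finType) (eW : rel W) (f : W -> V).

Lemma edgesP x y :
  reflect (exists a b, [/\ x = f a, y = f b & eW a b]) ((x, y) \in edges eW f).
Proof.
apply: (iffP imsetP) => [[[a b]]|[a [b [-> -> ab]]]].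
  by rewrite inE /= => ab [-> ->]; exists a, b.
by exists (a, b); rewrite ?inE.
Qed.

Hypothesis fI : injective f.

Lemma edges_im a b : ((f a, f b) \in edges eW f) = eW a b.
Proof.
apply/edgesP/idP => [[a' [b' [/fI-> /fI->]]] //|ab]; by exists a, b.
Qed.

Lemma card_edges : #|edges eW f| = #|[set p : W * W | eW p.1 p.2]|.
Proof. by apply: card_imset => -[a b] [a' b'] /= [/fI-> /fI->]. Qed.

Lemma card_im : #|im f| = #|W|.
Proof. by rewrite card_imset ?cardsT. Qed.

Lemma in_imP x : reflect (exists a, x = f a) (x \in im f).
Proof. by apply: (iffP imsetP) => [[a _ ->]|[a ->]]; exists a. Qed.
End Edges.

(* A decomposition, given by parametrizations of its two parts. *)
Record gcover (V W1 W2 : finType) (e : rel V) (e1 : rel W1) (e2 : rel W2)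
    (f1 : W1 -> V) (f2 : W2 -> V) : Prop := GCover {
  cover_inj1 : injective f1;
  cover_inj2 : injective f2;
  cover_vert : im f1 :|: im f2 = setT;
  cover_edge : forall x y, e x y = ((x, y) \in edges e1 f1) || ((x, y) \in edges e2 f2) }.

Section Cover.
Variables (V W1 W2 : finType) (e : rel V) (e1 : rel W1) (e2 : rel W2).

Lemma coverC f1 f2 : gcover e e1 e2 f1 f2 -> gcover e e2 e1 f2 f1.
Proof. by case=> i1 i2 v E; split=> // [|x y]; rewrite ?E 1?setUC 1?orbC. Qed.

Lemma cover_hom1 f1 f2 a b : gcover e e1 e2 f1 f2 -> e1 a b -> e (f1 a) (f1 b).
Proof. by case=> i1 i2 v E ab; rewrite E edges_im ?ab. Qed.

Lemma cover_hom2 f1 f2 a b : gcover e e1 e2 f1 f2 -> e2 a b -> e (f2 a) (f2 b).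
Proof. by case=> i1 i2 v E ab; rewrite E [X in _ || X]edges_im ?ab ?orbT. Qed.

(** By inclusion-exclusion, the overlap of the two parts has the same size in every decomposition of
    a given graph. *)
Lemma cover_card f1 f2 : gcover e e1 e2 f1 f2 ->
  #|V| + #|im f1 :&: im f2| = #|W1| + #|W2|.
Proof.
case=> i1 i2 v _; rewrite -(cardsT V) -v cardsU -(card_im i1) -(card_im i2) subnK //.
by apply: leq_trans (leq_addr _ _); apply/subset_leq_card/subsetIl.
Qed.

Lemma cover_in f1 f2 x : gcover e e1 e2 f1 f2 -> x \notin im f1 -> x \in im f2.
Proof. by case=> _ _ v _ xn; have := in_setT x; rewrite -v inE (negPf xn). Qed.

Lemma cover_cross f1 f2 x y : gcover e e1 e2 f1 f2 ->
  x \notin im f2 -> y \notin im f1 -> ~~ e x y.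
Proof.
case=> _ _ _ E x2 y1; rewrite E; apply/norP; split; apply/edgesP => -[a [b [xa yb _]]].
  by rewrite yb imset_f in y1.
by rewrite xa imset_f in x2.
Qed.

Lemma cover_conn f1 f2 z : gcover e e1 e2 f1 f2 -> symmetric e ->
  conn e1 setT -> conn e2 setT -> z \in im f1 -> z \in im f2 -> conn e setT.
Proof.
move=> C se c1 c2 z1 z2; rewrite -(cover_vert C).
apply: (connU se _ _ z1 z2); [apply: conn_im c1|apply: conn_im c2] => x y _ _.
  exact: cover_hom1 C.
exact: cover_hom2 C.
Qed.

Lemma cover_decomposition f1 f2 : symmetric e1 -> symmetric e2 -> gcover e e1 e2 f1 f2 ->
  is_decomposition e e1 e2 ((im f1, edges e1 f1), (im f2, edges e2 f2)).
Proof.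
move=> s1 s2 C; have [i1 i2 v E] := C; split; last split; last split; last split; last split => //=.
- case=> x y /= xy; move: (xy) => /edgesP[a [b [xa yb ab]]].
  rewrite xa yb !imset_f // edges_im // s1 ab; split=> //; exact: cover_hom1 C ab.
- case=> x y /= xy; move: (xy) => /edgesP[a [b [xa yb ab]]].
  rewrite xa yb !imset_f // edges_im // s2 ab; split=> //; exact: cover_hom2 C ab.
- by exists f1; split=> // a b; rewrite edges_im.
- by exists f2; split=> // a b; rewrite edges_im.
by apply/setP => -[x y]; rewrite !inE E.
Qed.

Lemma decomposition_cover d : is_decomposition e e1 e2 d ->
  exists f1 f2, gcover e e1 e2 f1 f2 /\ d = ((im f1, edges e1 f1), (im f2, edges e2 f2)).
Proof.
case: d => [[A1 E1] [A2 E2]] [/= S1 [S2 [[f1 [/= i1 im1 h1]] [[f2 [/= i2 im2 h2]] [vU eU]]]]].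
have edgeE (W : finType) (eW : rel W) (f : W -> V) A E : is_subgraph e (A, E) ->
    injective f -> im f = A -> (forall x y, eW x y = ((f x, f y) \in E)) -> edges eW f = E.
  move=> S fI imf h; apply/setP => -[x y]; apply/idP/idP => [/edgesP[a [b [-> -> ab]]]|xyE].
    by rewrite -h.
  have [/= xA yA _ _] := S _ xyE; move: xA yA xyE; rewrite -imf => /imsetP[a _ ->] /imsetP[b _ ->].
  by rewrite edges_im // h.
have D1 := edgeE _ _ _ _ _ S1 i1 im1 h1; have D2 := edgeE _ _ _ _ _ S2 i2 im2 h2.
exists f1, f2; split; last by rewrite im1 im2 D1 D2.
split=> //; first by rewrite im1 im2.
by move=> x y; rewrite D1 D2; have /setP/(_ (x, y)) := eU; rewrite !inE => ->.
Qed.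

(** Parametrizations may differ by automorphisms, so only their vertex and edge images are
    compared. *)
Lemma cover_unique f1 f2 : symmetric e1 -> symmetric e2 -> gcover e e1 e2 f1 f2 ->
  (forall g1 g2, gcover e e1 e2 g1 g2 ->
     [/\ im g1 = im f1, im g2 = im f2, edges e1 g1 = edges e1 f1 & edges e2 g2 = edges e2 f2]) ->
  uniquely_decomposable e e1 e2.
Proof.
move=> s1 s2 C U; exists ((im f1, edges e1 f1), (im f2, edges e2 f2)).
split; first exact: cover_decomposition.
by move=> d /decomposition_cover[g1 [g2 [/U[-> -> -> ->] ->]]].
Qed.
End Cover.

Lemma uniquely_decomposableC (V W1 W2 : finType) (e : rel V) (e1 : rel W1) (e2 : rel W2) :
  uniquely_decomposable e e1 e2 -> uniquely_decomposable e e2 e1.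
Proof.
have swap (U1 U2 : finType) (d1 : rel U1) (d2 : rel U2) d :
    is_decomposition e d1 d2 d -> is_decomposition e d2 d1 (d.2, d.1).
  by case=> [? [? [? [? [? ?]]]]]; do !split=> //=; rewrite setUC.
case=> -[A B] [dAB U]; exists (B, A); split; first exact: swap dAB.
by case=> A' B' /swap/U[-> ->].
Qed.

Section Amalgam.
Variables (W1 W2 : finType) (e1 : rel W1) (e2 : rel W2) (T : {set W2}) (g : W2 -> W1).
Hypotheses (G1 : simple_graph e1) (G2 : simple_graph e2) (gI : {in T &, injective g}).

(** The vertices are those of [W1] and those of [W2] outside [T]; a vertex of [T] is represented by
    its image under [g]. An edge between glued vertices may come from either graph or from both. *)
Lemma amalgam : exists (V : finType) (e : rel V) (f1 : W1 -> V) (f2 : W2 -> V),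
  [/\ simple_graph e, gcover e e1 e2 f1 f2 &
      forall a b, f1 a = f2 b <-> b \in T /\ a = g b].
Proof.
pose S := {y : W2 | y \notin T}; pose V : finType := (W1 + S)%type.
pose f1 (a : W1) : V := inl a.
pose f2 (b : W2) : V := if insub b is Some z then inr z else inl (g b).
have f2T b : b \in T -> f2 b = inl (g b) by move=> bT; rewrite /f2 insubF ?bT.
have f2N b (bT : b \notin T) : f2 b = inr (Sub b bT) by rewrite /f2 insubT.
have i1 : injective f1 by move=> a b [].
have i2 : injective f2.
  move=> a b; have [aT|aT] := boolP (a \in T); have [bT|bT] := boolP (b \in T).
  - by rewrite !f2T // => -[]; apply: gI.
  - by rewrite f2T // f2N.
  - by rewrite f2N f2T.
  by rewrite !f2N => -[].
pose e : rel V := fun x y => ((x, y) \in edges e1 f1) || ((x, y) \in edges e2 f2).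
have symE (W : finType) (eW : rel W) (f : W -> V) x y : symmetric eW ->
    (x, y) \in edges eW f -> (y, x) \in edges eW f.
  by move=> sW /edgesP[a [b [-> -> ab]]]; apply/edgesP; exists b, a; rewrite sW.
have irrE (W : finType) (eW : rel W) (f : W -> V) x : injective f -> irreflexive eW ->
    (x, x) \notin edges eW f.
  move=> fI iW; apply/edgesP => -[a [b [-> /fI-> ]]]; by rewrite iW.
have [[s1 r1] [s2 r2]] := (G1, G2).
exists V, e, f1, f2; split.
- split=> [x y|x]; last by rewrite /e (negPf (irrE _ _ _ _ i1 r1)) (negPf (irrE _ _ _ _ i2 r2)).
  by apply/idP/idP => /orP[] /symE h; apply/orP; [left|right|left|right]; apply: h.
- split=> //; apply/setP => -[a|[b bT]]; rewrite !inE.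
    by rewrite (imset_f f1).
  apply/orP; right; apply/imsetP; exists b => //.
  by rewrite f2N; congr inr; apply: val_inj.
move=> a b; split=> [|[bT ->]]; last by rewrite f2T.
have [bT|bT] := boolP (b \in T); first by rewrite f2T // => -[->].
by rewrite f2N.
Qed.
End Amalgam.

(** * Distances *)

Fixpoint walk (V : finType) (e : rel V) n x y : bool :=
  if n is n'.+1 then [exists z, walk e n' x z && e z y] else x == y.

Section Walk.
Variables (V : finType) (e : rel V).

Lemma walkS n x y z : walk e n x y -> e y z -> walk e n.+1 x z.
Proof. by move=> w yz; apply/existsP; exists y; apply/andP; split. Qed.

Lemma walk_cons n x y z : e x y -> walk e n y z -> walk e n.+1 x z.
Proof.
elim: n z => [|n IH] z xy /=.
  by move/eqP<-; apply: (@walkS 0) xy => /=.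
case/existsP=> t /andP[w tz]; exact: walkS (IH _ xy w) tz.
Qed.

Lemma walk_sym n x y : symmetric e -> walk e n x y -> walk e n y x.
Proof.
move=> se; elim: n y => [|n IH] y /=; first by rewrite eq_sym.
by case/existsP=> t /andP[/IH w ty]; apply: walk_cons w; rewrite se.
Qed.

(** Such a potential [h] bounds distances in a glued graph from below without any description of its
    shortest paths. *)
Lemma walk_lip (h : V -> nat) n x y : (forall a b, e a b -> h b <= (h a).+1) ->
  walk e n x y -> h y <= h x + n.
Proof.
move=> L; elim: n y => [|n IH] y /=; first by move/eqP->; rewrite addn0.
by case/existsP=> t /andP[/IH w /L]; lia.
Qed.

Lemma walk_exists x y : connected_graph e -> exists n, walk e n x y.
Proof.
case=> _ cV; have /connectP[s + ->] := cV x y; elim/last_ind: s => [|s z IH].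
  by exists 0 => /=.
rewrite rcons_path last_rcons => /andP[/IH[n w] tz]; exists n.+1; exact: walkS w tz.
Qed.

Lemma dist_exists x : connected_graph e -> exists h : V -> nat,
  [/\ h x = 0, forall y, walk e (h y) x y /\ (forall n, walk e n x y -> h y <= n),
      forall a b, e a b -> h b <= (h a).+1 &
      forall y, y != x -> exists2 z, e z y & h y = (h z).+1].
Proof.
move=> cV; have W y := walk_exists x y cV.
pose h y := ex_minn (W y).
have hw y : walk e (h y) x y by rewrite /h; case: ex_minnP.
have hm y n : walk e n x y -> h y <= n by rewrite /h; case: ex_minnP => m _; apply.
exists h; split=> //.
- by apply/eqP; rewrite -leqn0; apply: hm => /=.
- by move=> y; split=> [|n]; [apply: hw|apply: hm].
- by move=> a b ab; apply: hm; apply: walkS (hw a) ab.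
move=> y yx; have := hw y; case E: (h y) => [|n] /=; first by rewrite eq_sym (negPf yx).
case/existsP=> z /andP[w zy]; exists z => //; congr _.+1; apply/eqP; rewrite eqn_leq (hm _ _ w) andbT.
by rewrite -ltnS -E; apply: hm; apply: walkS (hw z) zy.
Qed.
End Walk.

(** [D] is the maximum over [P] of the least [n] with [Q u n], attained at [u]. Applied to pairs of
    vertices it gives the diameter, applied to leaves the greatest distance from a leaf to the
    nearest vertex of degree at least 3. *)
Lemma least_uniform_bound (U : finType) (P : pred U) (Q : U -> nat -> bool) :
  (exists u, P u) -> (forall u, P u -> exists n, Q u n) ->
  exists D u, [/\ P u, forall n, n < D -> ~~ Q u n &
    forall v, P v -> exists2 n, n <= D & Q v n].
Proof.
move=> P0 PQ.
have ex : exists N, [forall v, P v ==> [exists n : 'I_N.+1, Q v n]].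
  suff /fin_all_exists[N HN] : forall v, exists N, P v -> Q v N.
    exists (\max_v N v); apply/forallP => v; apply/implyP => Pv; apply/existsP.
    by exists (inord (N v)); rewrite inordK ?HN // ltnS leq_bigmax.
  move=> v; by have [/PQ[n Qn]|nP] := boolP (P v); [exists n|exists 0].
case: (ex_minnP ex) => D /forallP HD minD.
have HD' v : P v -> exists2 n, n <= D & Q v n.
  by move/(implyP (HD v))/existsP=> [[n ?] Qn]; exists n.
case: D HD minD HD' => [|D] _ minD HD.
  by case: P0 => u Pu; exists 0, u; split.
have : ~~ [forall v, P v ==> [exists n : 'I_D.+1, Q v n]].
  by apply/negP => /minD; rewrite ltnn.
case/forallPn=> u; rewrite negb_imply negb_exists => /andP[Pu /forallP no].
exists D.+1, u; split=> // n nD; exact: (no (Ordinal nD)).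
Qed.

(** [h] is the distance from [p], recorded through its Lipschitz property and the existence of
    predecessors. *)
Record diametral (V : finType) (e : rel V) D p q (h : V -> nat) : Prop := Diametral {
  diam_le : forall x y, exists2 n, n <= D & walk e n x y;
  diam_p : h p = 0;
  diam_q : h q = D;
  diam_max : forall x, h x <= D;
  diam_lip : forall a b, e a b -> h b <= (h a).+1;
  diam_pred : forall y, y != p -> exists2 z, e z y & h y = (h z).+1 }.

Lemma diametral_exists (V : finType) (e : rel V) : symmetric e -> connected_graph e ->
  exists D p q h h', diametral e D p q h /\ diametral e D q p h'.
Proof.
move=> se cV; have [V0 _] := cV; have [x0 _] := card_gt0P V0.
have [||D [[p q] [_ far near]]] :=
  @least_uniform_bound (V * V)%type xpredT (fun u n => walk e n u.1 u.2).
- by exists (x0, x0).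
- by move=> u _; apply: walk_exists.
have near' x y : exists2 n, n <= D & walk e n x y by have := near (x, y) isT.
have build a b : (forall n, n < D -> ~~ walk e n a b) -> exists h, diametral e D a b h.
  move=> fab; have [h [h0 hm hl hp]] := dist_exists a cV; exists h.
  have hD x : h x <= D by have [n nD /(hm x).2] := near' a x; lia.
  split=> //; apply/eqP; rewrite eqn_leq hD leqNgt; apply/negP => /fab.
  by rewrite (hm b).1.
have [h dh] := build _ _ far; have [|h' dh'] := build q p.
  by move=> n /far; apply: contra => /= /(walk_sym se).
by exists D, p, q, h, h'.
Qed.

(** An induced part is determined by its vertex set, so for one-point overlaps uniqueness reduces to
    vertex sets. *)
Lemma edges_induced (V W : finType) (e : rel V) (eW : rel W) (f : W -> V) :
  injective f -> (forall a b, e (f a) (f b) = eW a b) ->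
  edges eW f = [set p : V * V | [&& p.1 \in im f, p.2 \in im f & e p.1 p.2]].
Proof.
move=> fI hf; apply/setP => -[x y]; rewrite inE /=.
apply/edgesP/and3P => [[a [b [-> -> ab]]]|]; first by rewrite !imset_f // hf.
by case=> /imsetP[a _ ->] /imsetP[b _ ->]; rewrite hf => ab; exists a, b.
Qed.

Lemma iso_of_im (V W1 W2 : finType) (e : rel V) (e1 : rel W1) (e2 : rel W2)
    (f1 : W1 -> V) (f2 : W2 -> V) :
  injective f1 -> injective f2 -> im f1 = im f2 ->
  (forall a b, e (f1 a) (f1 b) = e1 a b) -> (forall a b, e (f2 a) (f2 b) = e2 a b) ->
  graph_iso e1 e2.
Proof.
move=> i1 i2 E h1 h2.
have /fin_all_exists[k kE] a : exists b, f1 a = f2 b.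
  by apply/in_imP; rewrite -E imset_f.
have kI : injective k by move=> a b kab; apply: i1; rewrite !kE kab.
exists k; split; last by move=> a b; rewrite -h2 -!kE h1.
by apply: inj_card_bij kI _; rewrite -(card_im i1) -(card_im i2) E.
Qed.

Lemma extend_fun (V W : finType) (f : W -> V) (h : W -> nat) (h' : V -> nat) :
  injective f -> exists k : V -> nat,
    (forall a, k (f a) = h a) /\ (forall x, x \notin im f -> k x = h' x).
Proof.
move=> fI; exists (fun x => if [pick a | f a == x] is Some a then h a else h' x).
split=> [a|x xf]; case: pickP => [b /eqP|no] //; first by move/fI->.
  by have := no a; rewrite eqxx.
by move=> E; rewrite -E imset_f in xf.
Qed.

(** * Gluing at the end of a diametral pair *)

Section OnePoint.
Variables (V W1 W2 : finType) (e : rel V) (e1 : rel W1) (e2 : rel W2).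
Hypotheses (se : symmetric e) (ie : irreflexive e).

(** An edge of the second part inside the first would have both ends equal to [w], hence be a
    loop. *)
Lemma cover_one_point_induced f1 f2 w : gcover e e1 e2 f1 f2 -> im f1 :&: im f2 = [set w] ->
  forall a b, e (f1 a) (f1 b) = e1 a b.
Proof.
move=> C E a b; have [i1 i2 _ eE] := C; rewrite eE edges_im //.
case: (boolP (e1 a b)) => //= _; apply/edgesP => -[a' [b' [Ea Eb ab]]].
have inw a0 b0 : f1 a0 = f2 b0 -> f1 a0 = w.
  by move=> E0; apply/set1P; rewrite -E inE imset_f // E0 imset_f.
by have := cover_hom2 C ab; rewrite -Ea -Eb (inw _ _ Ea) (inw _ _ Eb) ie.
Qed.

Lemma cover_one_sum f1 f2 w : gcover e e1 e2 f1 f2 -> im f1 :&: im f2 = [set w] ->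
  one_sum e (im f1) (im f2) w.
Proof.
move=> C E; split=> // x y x1 y2 xw yw; apply: (cover_cross C).
  by apply: contra xw => x2; rewrite -in_set1 -E inE x1.
by apply: contra yw => y1; rewrite -in_set1 -E inE y1.
Qed.
End OnePoint.

(** An induced copy of [eW] hanging at the root [w]. The marked vertices [p] inside and [q] outside
    fix which side of [w] the copy occupies. *)
Record pendant (V W : finType) (e : rel V) (eW : rel W) w p q (k : W -> V) : Prop := Pendant {
  pend_inj : injective k;
  pend_iso : forall a b, e (k a) (k b) = eW a b;
  pend_w : w \in im k;
  pend_p : p \in im k;
  pend_pw : p != w;
  pend_q : q \notin im k;
  pend_out : forall x y, x \in im k -> x != w -> y \notin im k -> ~~ e x y }.

Lemma simple_walk_im (V W : finType) (e : rel V) (eW : rel W) (f : W -> V) n x y :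
  (forall a b, eW a b -> e (f a) (f b)) -> walk eW n x y -> walk e n (f x) (f y).
Proof.
move=> hf; elim: n y => [|n IH] y /=; first by move/eqP->.
by case/existsP=> z /andP[/IH w /hf zy]; apply/existsP; exists (f z); apply/andP.
Qed.

(** Predecessors lead from any vertex other than [q] down to [p], and never through [q]: a vertex
    with predecessor [q] would have height [D.+1]. *)
Lemma diametral_noncut (V : finType) (e : rel V) D p q h : symmetric e ->
  diametral e D p q h -> conn e (setT :\ q).
Proof.
move=> se [_ hp hq hm hl hpred]; apply/connP => P x0 x0X x0P clP.
have [pq|pq] := eqVneq p q.
  have D0 : D = 0 by rewrite -hq -pq.
  have x0p : x0 != p by rewrite pq; case/setD1P: x0X.
  by have [z _ hz] := hpred _ x0p; have := hm x0; rewrite D0 hz.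
have down x : x != q -> (x \in P) = (p \in P).
  move: {2}(h x) (erefl (h x)) => n; elim: n x => [|n IH] x hx xq.
    have [->//|/hpred[z _]] := eqVneq x p; by rewrite hx.
  have [->//|xp] := eqVneq x p; have [z zx hz] := hpred _ xp.
  have hzn : h z = n by move: hx; rewrite hz => -[].
  have zq : z != q.
    by apply/eqP => zq; have := hm x; rewrite hz zq hq ltnn.
  rewrite -(IH z hzn zq); apply/idP/idP => h1.
    by apply: (clP x) => //; rewrite ?inE ?xq ?zq // se.
  by apply: (clP z) => //; rewrite ?inE ?xq ?zq.
case/setD1P: x0X => x0q _; apply/subsetP => x /setD1P[xq _].
by rewrite (down x xq) -(down x0 x0q).
Qed.

Section EndSum.
Variables (W1 W2 : finType) (e1 : rel W1) (e2 : rel W2).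
Hypotheses (S1 : simple_graph e1) (S2 : simple_graph e2).
Hypotheses (c1 : connected_graph e1) (c2 : connected_graph e2).
Hypotheses (n21 : #|W2| <= #|W1|) (n2 : 1 < #|W2|) (ni : ~ graph_iso e1 e2).

Lemma point_amalgam u v : exists (V : finType) (e : rel V) (f1 : W1 -> V) (f2 : W2 -> V),
  [/\ simple_graph e, connected_graph e, gcover e e1 e2 f1 f2, im f1 :&: im f2 = [set f1 u] &
      f1 u = f2 v].
Proof.
have [|V [e [f1 [f2 [Se C E]]]]] := @amalgam W1 W2 e1 e2 [set v] (fun=> u) S1 S2.
  by move=> a b /set1P-> /set1P->.
have uv : f1 u = f2 v by apply/E; rewrite inE.
have I : im f1 :&: im f2 = [set f1 u].
  apply/setP => x; rewrite !inE; apply/andP/eqP => [[/imsetP[a _ ->] /imsetP[b _]]|->].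
    by move=> ab; have /E[_ ->] := ab.
  by rewrite imset_f // uv imset_f.
exists V, e, f1, f2; split=> //; apply: conn_connected.
  by apply/card_gt0P; exists (f1 u).
have : f1 u \in im f1 :&: im f2 by rewrite I inE.
case/setIP=> h1 h2; apply: (cover_conn C Se.1 _ _ h1 h2); exact: connected_conn.
Qed.

(** Glue [v] to [q]. The final equation compares two ways of cutting the result into 1-sums. It
    makes the root [w] non-cut on both sides if [v] is non-cut in [e2], and on exactly one side if
    [v] is a cut vertex. *)
Lemma end_sum D p q h v : diametral e1 D p q h ->
  exists (V : finType) (e : rel V),
    [/\ simple_graph e, connected_graph e, #|V|.+1 = #|W1| + #|W2| &
        ~ uniquely_decomposable e e1 e2 -> exists w k, pendant e1 e2 w p q k /\
          (w \in noncut e1 (im k)) + (w \in noncut e1 (w |: ~: im k)) =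
          (v \in noncut e2 setT).+1].
Proof.
move=> dq; have [V [e [f1 [f2 [Se ce C I fuv]]]]] := point_amalgam q v.
have [[[s1 r1] [s2 r2]] [se re]] := (S1, S2, Se).
have cardV : #|V|.+1 = #|W1| + #|W2| by rewrite -(cover_card C) I cards1 addn1.
exists V, e; split=> // nU; apply: NNPP => no; apply: nU.
apply: (cover_unique s1 s2 C) => g1 g2 C'.
have /eqP/cards1P[w Iw] : #|im g1 :&: im g2| = 1.
  by move: (cover_card C'); rewrite -cardV; clear; lia.
have [[[i1 i2] j1] j2] := (cover_inj1 C, cover_inj2 C, cover_inj1 C', cover_inj2 C').
have S := cover_one_sum C I; have S' := cover_one_sum C' Iw.
have ind1 := cover_one_point_induced re C I.
have ind2 : forall a b, e (f2 a) (f2 b) = e2 a b.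
  by apply: (cover_one_point_induced re (coverC C)); rewrite setIC; apply: I.
have jnd1 := cover_one_point_induced re C' Iw.
have jnd2 : forall a b, e (g2 a) (g2 b) = e2 a b.
  by apply: (cover_one_point_induced re (coverC C')); rewrite setIC; apply: Iw.
set A1 := im f1 in I S; set A2 := im f2 in I S; set V1 := im g1 in Iw S'; set V2 := im g2 in Iw S'.
set c := f1 q in fuv I S.
have [cA1A cA2A] : c \in A1 /\ c \in A2 by apply/setIP; rewrite I inE.
have [wV1 wV2] : w \in V1 /\ w \in V2 by apply/setIP; rewrite Iw inE.
have cA1 : conn e A1 by rewrite (conn_im_eq i1 (fun x y _ _ => ind1 x y)) connected_conn.
have cA2 : conn e A2 by rewrite (conn_im_eq i2 (fun x y _ _ => ind2 x y)) connected_conn.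
have cA1c : conn e (A1 :\ c).
  by rewrite -imsetD1 // (conn_im_eq i1 (fun x y _ _ => ind1 x y)); apply: diametral_noncut dq.
have out x : x \notin V1 -> x \in V2 := cover_in C'.
have w12 x : x \in V1 -> x \in V2 -> x = w.
  by move=> x1 x2; apply/set1P; rewrite -Iw inE x1.
have c12 x : x \in A1 -> x \in A2 -> x = c.
  by move=> x1 x2; apply/set1P; rewrite -I inE x1.
have nA1 : #|A1| = #|W1| by apply: card_im.
have nA2 : #|A2| = #|W2| by apply: card_im.
have nV1 : #|V1| = #|W1| by apply: card_im.
have nV2 : #|V2| = #|W2| by apply: card_im.
(* If [w] is not in the connected set [A1 :\ c], this set lies in one part. In [V1] it gives the
   original decomposition; in [V2] it makes [A1] and [V2] equal by size, against [ni]. *)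
have [wA1c|wA1c] := boolP (w \in A1 :\ c); last first.
  have [a aA1 /andP[ac ca]] : exists2 a, a \in A1 & (a != c) && e c a.
    have [b] : exists b, b \in A1 :\ c.
      by apply/set0Pn; rewrite -card_gt0; move: (leq_trans n2 n21); rewrite -nA1 (cardsD1 c A1) cA1A add1n ltnS.
    by case/setD1P=> bc bA1; apply: (conn_nbr cA1 cA1A bA1); rewrite eq_sym.
  have aA1c : a \in A1 :\ c by rewrite !inE ac.
  have aw : a != w by apply: contraNneq wA1c => <-.
  have [sub|sub] : A1 \subset V1 \/ A1 \subset V2.
    have [|sub|sub] := @conn_side _ e (A1 :\ c) V1 cA1c.
    - move=> x y xA yA x1 y1; apply: S'.2 => //; first exact: out.
        by apply: contraNneq wA1c => <-.
      by apply: contraNneq y1 => ->.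
    - left; rewrite -(setD1K cA1A) subUset sub1set sub andbT.
      apply/negPn/negP => c1n; have cw : c != w by apply: contraNneq c1n => ->.
      by have := S'.2 a c (subsetP sub a aA1c) (out _ c1n) aw cw; rewrite se ca.
    right; rewrite -(setD1K cA1A) subUset sub1set; apply/andP; split; last first.
      by apply/subsetP => x /sub/out.
    have a2 := sub a aA1c; apply/negPn/negP => c2n.
    have c1n : c \in V1 by apply: contraNT c2n => /out.
    have cw : c != w by apply: contraNneq c2n => ->.
    by have := S'.2 c a c1n (out _ a2) cw aw; rewrite ca.
  - have A1V1 : V1 = A1 by apply/eqP; rewrite eq_sym eqEcard sub nA1 nV1 leqnn.
    have wc : w = c by apply/eqP; apply: contraNT wA1c => wc; rewrite !inE wc -A1V1.
    have A2V2 : V2 = A2.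
      apply/eqP; rewrite eq_sym eqEcard nA2 nV2 leqnn andbT; apply/subsetP => x xA2.
      have [->|xc] := eqVneq x c; first by rewrite -wc.
      by apply: out; rewrite A1V1; apply: contra xc => /c12->.
    by rewrite (edges_induced i1 ind1) (edges_induced i2 ind2) (edges_induced j1 jnd1)
      (edges_induced j2 jnd2) -/A1 -/A2 -/V1 -/V2 A1V1 A2V2.
  case: ni; apply: (iso_of_im i1 j2 _ ind1 jnd2); apply/eqP; rewrite eqEcard sub.
  by rewrite nV2 nA1.
case/setD1P: wA1c => wc wA1.
have wA2 : w \notin A2 by apply: contra wc => /(c12 _ wA1)->.
(* [A2] avoids [w], so it lies in one part; inside [V2] it would equal [V2] and contain [w]. *)
have A2V1 : A2 \subset V1.
  have [|//|sub] := @conn_side _ e A2 V1 cA2.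
    move=> x y xA yA x1 y1; apply: S'.2 => //; first exact: out.
      by apply: contraNneq wA2 => <-.
    by apply: contraNneq wA2 => <-.
  case/negP: wA2; have -> : A2 = V2; last by [].
  apply/eqP; rewrite eqEcard nA2 nV2 leqnn andbT; apply/subsetP => x /sub; exact: out.
have V2A1 : V2 \subset A1.
  apply/subsetP => x x2; have [//|/(cover_in C) xA2] := boolP (x \in A1).
  by case/negP: wA2; rewrite -(w12 x) ?(subsetP A2V1).
have cV2 : c \notin V2 by apply: contra wc => cV2; rewrite eq_sym (w12 c) ?(subsetP A2V1).
have [k kE] : exists k : W2 -> W1, forall b, g2 b = f1 (k b).
  suff /fin_all_exists : forall b, exists a, g2 b = f1 a by [].
  by move=> b; apply/in_imP/(subsetP V2A1)/imset_f.
have imk : f1 @: im k = V2.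
  by rewrite -imset_comp; apply: eq_imset => b /=; rewrite kE.
have kI a : (f1 a \in V2) = (a \in im k) by rewrite -imk mem_imset.
have [w0 wE] : exists w0, w = f1 w0 by apply/in_imP.
have pV1 : f1 p \notin V1.
  have [b bv] : exists b, b \in [set: W2] :\ v.
    by apply/set0Pn; rewrite -card_gt0; move: n2; rewrite -(cardsT W2) (cardsD1 v [set: W2]) inE add1n ltnS.
  have bA1 : f2 b \notin A1.
    apply/negP => bA1; have := c12 _ bA1 (imset_f f2 (in_setT b)).
    by rewrite fuv => /i2 E; rewrite E !inE eqxx in bv.
  (* Otherwise im g1 contains f1 p and f2 b, which are at distance more than D. *)
  have [Phi [Ph1 Ph2]] := @extend_fun V W1 f1 h (fun=> D.+1) i1.
  have [_ hp hq hm hl _] := dq.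
  (* [Phi] extends [h] by the value [D.+1] outside [A1]. Edges leave [A1] only at [c], where [h] has
     the value [D]. *)
  have Lip x y : e x y -> Phi y <= (Phi x).+1.
    have [/in_imP[a ->]|xA1] := boolP (x \in A1); have [/in_imP[a' ->]|yA1] := boolP (y \in A1).
    - by rewrite ind1 !Ph1; apply: hl.
    - move=> xy; rewrite Ph1 Ph2 //; have yA2 := cover_in C yA1.
      have [ac|ac] := eqVneq (f1 a) c; first by rewrite (i1 _ _ ac) hq.
      have yc : y != c by apply: contraNneq yA1 => ->.
      by have := S.2 _ _ (imset_f f1 (in_setT a)) yA2 ac yc; rewrite xy.
    - by move=> _; rewrite Ph1 Ph2 //; move: (hm a'); clear; lia.
    by rewrite !Ph2.
  apply/negP => /in_imP[p' pE].
  have /in_imP[s sE] : f2 b \in V1 by apply: (subsetP A2V1); apply: imset_f.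
  have [n nD wn] := diam_le dq p' s.
  have := simple_walk_im (e := e) (f := g1) (fun x y => cover_hom1 C') wn.
  rewrite -pE -sE => /(walk_lip Lip); rewrite Ph1 Ph2 // hp; move: nD; clear; lia.
have pw : p != w0 by apply: contraNneq pV1 => ->; rewrite -wE.
have pk : p \in im k by rewrite -kI out.
have qk : q \notin im k by rewrite -kI.
case: no; exists w0, k; split.
  split=> //; first by move=> a b kab; apply: j2; rewrite !kE kab.
  - by move=> a b; rewrite -ind1 -!kE jnd2.
  - by rewrite -kI -wE.
  move=> x y; rewrite -!kI => x2 xw y2; rewrite -ind1 se.
  apply: S'.2 => //; first by apply: contraNT y2 => /out.
    by apply: contraNneq y2 => ->.
  by rewrite wE (inj_eq i1).
(* Compare the numbers of non-cut vertices of the 1-sums A1 = Q + V2 (at w) and V1 = Q + A2 (at c),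
   both isomorphic to G1. *)
pose Q0 := w0 |: ~: im k; pose Q := f1 @: Q0.
have inQ x : (x \in Q) = (x \in A1) && ((x == w) || (x \notin V2)).
  apply/imsetP/andP => [[a aQ ->]|[/in_imP[a ->] aQ]].
    by rewrite imset_f // kI wE (inj_eq i1); move: aQ; rewrite !inE.
  by exists a => //; rewrite !inE -kI -(inj_eq i1) -wE.
have eV1 : V1 = Q :|: A2.
  apply/setP => x; rewrite inE inQ; apply/idP/orP => [x1|[/andP[xA /orP[/eqP->|xV]]|/(subsetP A2V1)]] //.
    have [xA|/(cover_in C)] := boolP (x \in A1); last by right.
    by left; have [//|xw] := eqVneq x w; rewrite /=; apply: contra xw => /(w12 x x1)->.
  by apply: contraNT xV => /out.
have eA1 : A1 = Q :|: V2.
  apply/setP => x; rewrite inE inQ; apply/idP/orP => [->|[/andP[]//|/(subsetP V2A1)//]].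
  by have [x2|x2] := boolP (x \in V2); [right|left; rewrite orbT].
have SQ : one_sum e Q A2 c.
  split; last by move=> x y; rewrite inQ => /andP[xA _]; apply: S.2.
  apply/setP => x; rewrite -I !inE inQ; have [->|] := eqVneq x c; last first.
    by move=> xc; apply/andP/andP=> -[] => [/andP[//]|xA xA2]; rewrite (c12 x xA xA2) eqxx in xc.
  by rewrite cV2 orbT andbT.
have SQ' : one_sum e Q V2 w.
  split=> [|x y].
    apply/setP => x; rewrite !inE inQ; have [->|xw] := eqVneq x w; first by rewrite wA1 wV2.
    by rewrite andbC; case: (x \in V2); rewrite ?andbF.
  rewrite inQ => /andP[xA xV] y2 xw yw; rewrite (negPf xw) /= in xV.
  by apply: S'.2; rewrite // -[_ \in _]negbK; apply: contra xV => /out.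
have cVV2 : conn e V2 by rewrite (conn_im_eq j2 (fun x y _ _ => jnd2 x y)) connected_conn.
have cQ : conn e Q by apply: (one_sum_l se SQ'); rewrite -eA1.
have cin : c \in Q by rewrite inQ cA1A cV2 orbT.
have win : w \in Q by rewrite inQ wA1 eqxx.
have cw : c != w by rewrite eq_sym.
have [s sA2 sc] : exists2 s, s \in A2 & s != c.
  have [s] : exists s, s \in A2 :\ c.
    by apply/set0Pn; rewrite -card_gt0; move: n2; rewrite -nA2 (cardsD1 c A2) cA2A add1n ltnS.
  by case/setD1P=> ? ?; exists s.
have H1 := one_sum_card_noncut se SQ cQ cA2 win wc sA2 sc.
have pV2 : f1 p \in V2 by apply: out.
have pwV : f1 p != w by apply: contraNneq pV1 => ->.
have H2 := one_sum_card_noncut se SQ' cQ cVV2 cin cw pV2 pwV.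
rewrite -eV1 in H1; rewrite -eA1 in H2.
(* As [q] ends a diametral pair, [c] is non-cut in [A1] and therefore in [Q]. This is the source of
   the successor in the equation. *)
have cQc : c \in noncut e Q by rewrite inE cin -(one_sum_noncut se SQ' cVV2) // -eA1.
have nc (U : finType) (f : U -> V) (eU : rel U) (X : {set U}) : injective f ->
    (forall a b, e (f a) (f b) = eU a b) -> noncut e (f @: X) = f @: noncut eU X.
  by move=> fI hf; apply: card_noncut_im.
have E1 : #|noncut e V1| = #|noncut e A1|.
  by rewrite (nc _ _ _ _ j1 jnd1) (nc _ _ _ _ i1 ind1) !card_imset.
have E2 : #|noncut e V2| = #|noncut e A2|.
  by rewrite (nc _ _ _ _ j2 jnd2) (nc _ _ _ _ i2 ind2) !card_imset.
have E3 : (c \in noncut e A2) = (v \in noncut e2 setT).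
  by rewrite (nc _ _ _ _ i2 ind2) fuv mem_imset.
have E4 : (w \in noncut e V2) = (w0 \in noncut e1 (im k)).
  by rewrite -imk (nc _ _ _ _ i1 ind1) wE mem_imset.
have E5 : (w \in noncut e Q) = (w0 \in noncut e1 Q0).
  by rewrite (nc _ _ _ _ i1 ind1) wE mem_imset.
rewrite -E3 -E4 -E5; move: H1 H2; rewrite cQc E1 E2; clear; lia.
Qed.
End EndSum.

(** * Pendant copies and uniqueness of their roots *)

Section Pendant.
Variables (V W : finType) (e : rel V) (eW : rel W).
Hypotheses (se : symmetric e) (cV : conn e setT) (cW : conn eW setT).

Lemma pend_one_sum w p q (k : W -> V) : pendant e eW w p q k ->
  one_sum e (w |: ~: im k) (im k) w.
Proof.
move=> P; split=> [|x y].
  apply/setP => x; rewrite !inE; have [->|] := eqVneq x w; first by rewrite (pend_w P).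
  by rewrite /= andNb.
rewrite !inE => /orP[-> //|xk] yk _ yw; rewrite se; exact: (pend_out P).
Qed.

Lemma pend_conn w p q (k : W -> V) : pendant e eW w p q k -> conn e (im k).
Proof. by move=> P; rewrite (conn_im_eq (pend_inj P) (fun x y _ _ => pend_iso P x y)). Qed.

Lemma pend_co_conn w p q (k : W -> V) : pendant e eW w p q k -> conn e (w |: ~: im k).
Proof.
move=> P; apply: (one_sum_l se (pend_one_sum P)).
by rewrite -setUA [X in _ |: X]setUC setUCr setUT.
Qed.

Lemma pend_side w p q (k : W -> V) X x : pendant e eW w p q k ->
  conn e X -> w \notin X -> x \in X -> x \in im k -> X \subset im k.
Proof.
move=> P cX wX xX xk; have [|//|/(_ x xX)] := @conn_side _ e X (im k) cX.
  move=> a b aX bX ak bk; apply: (pend_out P) => //.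
  by apply: contraNneq wX => <-.
by rewrite xk.
Qed.

Lemma pend_card w p q (k : W -> V) : pendant e eW w p q k -> #|im k| = #|W|.
Proof. by move=> P; apply/card_im/(pend_inj P). Qed.

(** Otherwise the first copy, being connected and containing [p], would lie inside the second; by
    size the two would coincide, and the first would contain [w'] after all. *)
Lemma pend_root_in w w' p q (k k' : W -> V) :
  pendant e eW w p q k -> pendant e eW w' p q k' -> w' \in im k.
Proof.
move=> P P'; apply/negPn/negP => wk.
have sub := pend_side P' (pend_conn P) wk (pend_p P) (pend_p P').
case/negP: wk; suff -> : im k = im k' by apply: pend_w P'.
by apply/eqP; rewrite eqEcard sub (pend_card P) (pend_card P') leqnn.
Qed.

(** If the roots differed, the connected set [w |: ~: im k] would avoid [w'] and contain the vertex
    [w] of [im k']. It would then lie inside [im k'], although it contains [q]. *)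
Lemma pend_root_unique w w' p q (k k' : W -> V) :
  pendant e eW w p q k -> pendant e eW w' p q k' -> w = w'.
Proof.
move=> P P'; apply/eqP/negPn/negP => ww.
have wQ : w' \notin w |: ~: im k.
  by rewrite !inE negb_or negbK eq_sym ww (pend_root_in P P').
have /subsetP/(_ q) : w |: ~: im k \subset im k'.
  by apply: (pend_side P' (pend_co_conn P) wQ _ (pend_root_in P' P)); rewrite !inE eqxx.
by rewrite !inE (pend_q P) orbT (negPf (pend_q P')) => /(_ isT).
Qed.

Lemma pend_no_cut w p q (k : W -> V) x : (forall v, conn eW (setT :\ v)) ->
  pendant e eW w p q k -> conn e (im k :\ x).
Proof.
move=> cut P; have [/in_imP[v ->]|xk] := boolP (x \in im k).
  by rewrite -imsetD1 ?(conn_im_eq (pend_inj P) (fun x y _ _ => pend_iso P x y)) //; apply: pend_inj P.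
rewrite (_ : _ :\ x = im k) ?(pend_conn P) //; apply/setP => y; rewrite !inE.
by case: eqP => // ->; rewrite (negPf xk).
Qed.
End Pendant.

(* The size bound excludes an isomorphism with either summand. *)
Definition composable (W1 W2 : finType) (e1 : rel W1) (e2 : rel W2) : Prop :=
  exists (V : finType) (e : rel V),
    [/\ simple_graph e, connected_graph e, maxn #|W1| #|W2| < #|V| &
        uniquely_decomposable e e1 e2].

(** * Absence of cut vertices in the smaller graph *)

Section TwoConnected.
Variables (W1 W2 : finType) (e1 : rel W1) (e2 : rel W2).
Hypotheses (S1 : simple_graph e1) (S2 : simple_graph e2).
Hypotheses (c1 : connected_graph e1) (c2 : connected_graph e2).
Hypotheses (n21 : #|W2| <= #|W1|) (n2 : 1 < #|W2|) (ni : ~ graph_iso e1 e2).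
Hypothesis ns : ~ composable e1 e2.

Lemma end_sum_pendant D p q h v : diametral e1 D p q h ->
  exists w k, pendant e1 e2 w p q k /\
    (w \in noncut e1 (im k)) + (w \in noncut e1 (w |: ~: im k)) = (v \in noncut e2 setT).+1.
Proof.
move=> dq; have [V [e [Se ce cV H]]] := end_sum S1 S2 c1 c2 n21 n2 ni v dq.
apply: H => U; apply: ns; exists V, e; split=> //; move: cV n2 n21; lia.
Qed.

(* Gluing G2 at a cut vertex or at a non-cut vertex leads to the same pendant copy,
   but to different numbers of branches at its root. *)
Lemma end_sum_no_cut D p q h : diametral e1 D p q h -> forall v, conn e2 (setT :\ v).
Proof.
move=> dq v; have [[s1 _] [s2 _]] := (S1, S2).
have cW1 := connected_conn c1; have cW2 := connected_conn c2.
have [v0 nv0] : exists v0, v0 \in noncut e2 setT.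
  have [x [_ _ cx]] := noncut_exists s2 cW2 (in_setT v) (ltac:(by rewrite cardsT)).
  by exists x; rewrite inE in_setT.
have [w [k [P E]]] := end_sum_pendant v0 dq; rewrite nv0 in E.
have [w' [k' [P' E']]] := end_sum_pendant v dq.
have ww := pend_root_unique s1 cW1 cW2 P P'; subst w'.
(* For the non-cut vertex [v0] the sum is 2, so both of its terms are 1. *)
have [wk cwk] : w \in im k /\ conn e1 (im k :\ w).
  by apply/andP; move: E; rewrite inE; case: (_ && _) => //; case: (_ \in _).
(* [im k :\ w] is connected, avoids the common root and contains [p], so it lies in [im k']. Equal
   copies have equal counts, which forces [v] to be non-cut. *)
have kk : im k' = im k.
  apply/eqP; rewrite eq_sym eqEcard (pend_card P) (pend_card P') leqnn andbT.
  rewrite -(setD1K wk) subUset sub1set (pend_w P') /=.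
  apply: (pend_side P' cwk); [by rewrite !inE eqxx| |exact: pend_p P'].
  by rewrite in_setD1 (pend_pw P) (pend_p P).
by move: E'; rewrite kk E inE => /eqP; case: (conn e2 _); rewrite // andbF.
Qed.
End TwoConnected.

(** * Gluing at two vertices *)

Lemma setU1_two (T : finType) (A : {set T}) x : x \in A -> #|A| = 2 ->
  exists2 y, y != x & A = [set x; y].
Proof.
move=> xA; rewrite (cardsD1 x) xA add1n => -[] /eqP/cards1P[y Ay].
have : y \in A :\ x by rewrite Ay inE.
by case/setD1P=> yx _; exists y => //; rewrite -Ay setD1K.
Qed.

Lemma third_element (T : finType) (x y : T) : 2 < #|T| -> exists2 z, z != x & z != y.
Proof.
move=> T3; have : 0 < #|~: [set x; y]|.
  by have := cardsC [set x; y]; have := cards2 x y; move: T3; case: (x != y) => /=; lia.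
by case/card_gt0P=> z; rewrite !inE negb_or => /andP[]; exists z.
Qed.

Section TwoPoint.
Variables (V W1 W2 : finType) (e : rel V) (e1 : rel W1) (e2 : rel W2).
Hypotheses (se : symmetric e) (re : irreflexive e).

Lemma cover_side f1 f2 X : gcover e e1 e2 f1 f2 -> conn e X ->
  (forall x, x \in X -> x \in im f1 -> x \notin im f2) -> X \subset im f1 \/ X \subset im f2.
Proof.
move=> C cX dX; have [|//|sub] := @conn_side _ e X (im f1) cX; [|by left|].
  by move=> x y xX yX x1 y1; apply: (cover_cross C) => //; apply: dX.
by right; apply/subsetP => x /sub/(cover_in C).
Qed.

(** A pair not inside the second vertex set is an edge of the first part exactly when it is an edge
    of [e]. The only other possible edge joins the two common vertices, and counting the edges of
    [e1] tells whether the first part contains it. *)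
Lemma cover_edges_eq f1 f2 g1 g2 : symmetric e1 ->
  gcover e e1 e2 f1 f2 -> gcover e e1 e2 g1 g2 -> im g1 = im f1 -> im g2 = im f2 ->
  #|im f1 :&: im f2| = 2 -> edges e1 g1 = edges e1 f1.
Proof.
move=> s1 Cf Cg E1 E2 c2.
pose Z := [set p : V * V | (p.1 \in im f2) && (p.2 \in im f2)].
have off d1 d2 d1' d2' : gcover e e1 e2 d1 d2 -> gcover e e1 e2 d1' d2' -> im d2' = im f2 ->
    edges e1 d1 :\: Z \subset edges e1 d1' :\: Z.
  move=> Cd Cd' Ed; apply/subsetP => -[x y]; rewrite 2!in_setD => /andP[nZ xy]; rewrite nZ /=.
  have : e x y by rewrite (cover_edge Cd) xy.
  rewrite (cover_edge Cd') => /orP[//|/edgesP[a [b [xa yb _]]]].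
  by case/negP: nZ; rewrite inE /= -Ed xa yb !imset_f.
have [i1 j1] := (cover_inj1 Cf, cover_inj1 Cg).
have offE : edges e1 g1 :\: Z = edges e1 f1 :\: Z.
  by apply/eqP; rewrite eqEsubset (off _ _ _ _ Cg Cf) // (off _ _ _ _ Cf Cg).
have cardE : #|edges e1 g1 :&: Z| = #|edges e1 f1 :&: Z|.
  apply: (@addIn #|edges e1 f1 :\: Z|).
  by rewrite cardsID -offE cardsID (card_edges _ i1) (card_edges _ j1).
rewrite -(setID (edges e1 g1) Z) -(setID (edges e1 f1) Z) offE; congr (_ :|: _).
apply/esym/eqP; rewrite eqEcard cardE leqnn andbT.
have symE x y : (x, y) \in edges e1 g1 -> (y, x) \in edges e1 g1.
  by case/edgesP=> a [b [-> -> ab]]; rewrite edges_im // s1.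
have ptE x y (d : W1 -> V) : im d = im f1 -> (x, y) \in edges e1 d -> (x, y) \in Z ->
    x \in im f1 :&: im f2 /\ y \in im f1 :&: im f2.
  move=> Ed /edgesP[a [b [-> -> _]]]; rewrite !inE /= -Ed !imset_f //.
  by case/andP=> -> ->.
have neE x y d1 d2 : gcover e e1 e2 d1 d2 -> (x, y) \in edges e1 d1 -> x != y.
  by move=> Cd xy; apply: contraFneq (re y) => E; rewrite (cover_edge Cd) -{1}E xy.
apply/subsetP => -[x y] /setIP[xyf xyZ]; rewrite inE xyZ andbT.
have [xC yC] := ptE _ _ _ (erefl _) xyf xyZ; have xy := neE _ _ _ _ Cf xyf.
have [y' y'x EC] := setU1_two xC c2.
have yy : y' = y by move: yC; rewrite EC !inE eq_sym (negPf xy) => /eqP.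
have : 0 < #|edges e1 g1 :&: Z|.
  by rewrite cardE; apply/card_gt0P; exists (x, y); rewrite inE xyf.
case/card_gt0P=> -[x' z'] /setIP[zg zZ]; have [x'C z'C] := ptE _ _ _ E1 zg zZ.
have := neE _ _ _ _ Cg zg; move: x'C z'C zg; rewrite EC yy !inE.
case/orP=> /eqP-> /orP[] /eqP-> // zg; rewrite ?eqxx // => _; exact: symE.
Qed.
End TwoPoint.

Lemma conn_im_D1 (V W : finType) (e : rel V) (eW : rel W) (f : W -> V) (Y : {set W}) x :
  injective f -> (forall a b, eW a b -> e (f a) (f b)) -> conn eW Y ->
  (forall v, conn eW (Y :\ v)) -> conn e (f @: Y :\ x).
Proof.
move=> fI hf cY cYv; have [/imsetP[v _ ->]|xY] := boolP (x \in f @: Y).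
  by rewrite -imsetD1 //; apply: conn_im (cYv v) => a b _ _; apply: hf.
rewrite (_ : _ :\ x = f @: Y); first by apply: conn_im cY => a b _ _; apply: hf.
by apply/setP => y; rewrite in_setD1; case: eqP => // ->; rewrite (negPf xY).
Qed.

(** * Thickening one end of the larger graph *)

Section Thick.
Variables (W1 W2 : finType) (e1 : rel W1) (e2 : rel W2).
Hypotheses (S1 : simple_graph e1) (S2 : simple_graph e2).
Hypotheses (c1 : connected_graph e1) (c2 : connected_graph e2).
Hypotheses (n2 : 2 < #|W2|) (nc : forall v, conn e2 (setT :\ v)).
Variables (D : nat) (p q w w' : W1) (h : W1 -> nat) (k k' : W2 -> W1).
Hypotheses (dq : diametral e1 D p q h).
Hypotheses (Pq : pendant e1 e2 w q p k) (Pp : pendant e1 e2 w' p q k').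

(** Connectedness gives one neighbour [b1]; a second exists because deleting [b1] keeps the graph
    connected. *)
Lemma two_nbrs b : exists b1 b2, [/\ b1 != b2, e2 b b1 & e2 b b2].
Proof.
have [z zb _] := third_element b b n2.
have [|b1 _ /andP[b1b bb1]] := conn_nbr (connected_conn c2) (in_setT b) (in_setT z).
  by rewrite eq_sym.
have [y yb1 yb] := third_element b1 b n2.
have [|||b2 /setD1P[b21 _] /andP[_ bb2]] := @conn_nbr _ _ _ b y (nc b1).
- by rewrite !inE eq_sym b1b.
- by rewrite !inE yb1.
- by rewrite eq_sym.
by exists b1, b2; rewrite eq_sym.
Qed.

Lemma pend_conn_D1 w0 p0 q0 (k0 : W2 -> W1) x :
  pendant e1 e2 w0 p0 q0 k0 -> conn e1 (im k0 :\ x).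
Proof. by apply: pend_no_cut => //; apply: connected_conn. Qed.

(** Degree at most one. A pendant copy of [e2] contains no such vertex, so counting them detects a
    leaf left behind by a removed copy. *)
Definition low (a : W1) : bool := [forall b, forall b', e1 a b && e1 a b' ==> (b == b')].

Lemma pend_low w0 p0 q0 (k0 : W2 -> W1) a : pendant e1 e2 w0 p0 q0 k0 -> a \in im k0 -> ~~ low a.
Proof.
move=> P /in_imP[b ->]; have [b1 [b2 [b12 bb1 bb2]]] := two_nbrs b.
rewrite negb_forall; apply/existsP; exists (k0 b1); rewrite negb_forall.
apply/existsP; exists (k0 b2); rewrite negb_imply !(pend_iso P) bb1 bb2 /=.
by apply: contra b12 => /eqP/(pend_inj P)->.
Qed.

(* x is glued to q and y to a neighbour of q. Since s is not adjacent to y (unless G2 is complete),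
   it lies further away from p than q does. *)
Lemma glue_pair2 : exists x y s : W2,
  [/\ x != y, s != x, s != y, conn e2 (setT :\ y :\ x) & ~~ e2 y s \/ forall a b, a != b -> e2 a b].
Proof.
have [y [s [sy H]]] : exists y s, s != y /\ (~~ e2 y s \/ forall a b, a != b -> e2 a b).
  case: (pickP [pred u : W2 * W2 | (u.2 != u.1) && ~~ e2 u.1 u.2]) => [[y s] /andP[sy ys]|no].
    by exists y, s; split=> //; left.
  have [y _] := card_gt0P (ltn_trans (isT : 0 < 2) n2); have [s sy _] := third_element y y n2.
  exists y, s; split=> //; right => a b ab; have := no (a, b).
  by rewrite /= eq_sym ab /= => /negbFE.
(* Choosing [x] non-cut after the deletion of [y] keeps the unglued rest of [e2] connected; avoiding
   [s] gives [x != s]. *)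
have [||x [/setD1P[xy _] xs cx]] := @noncut_exists _ e2 (setT :\ y) s S2.1 (nc y).
- by rewrite !inE sy.
- by move: n2; rewrite -(cardsT W2) (cardsD1 y [set: W2]) inE add1n ltnS.
by exists x, y, s; split=> //; rewrite eq_sym.
Qed.

Lemma pend_qw : q != w. Proof. exact: pend_pw Pq. Qed.

(** As [w] is not a cut vertex of the copy, [q] has a neighbour [r] other than [w] in it. If [e2] is
    complete, take [m] of least height in the copy without [w]: its predecessor must be [w], a
    neighbour of [q], so [h q <= (h w).+1 = h m <= h r]. *)
Lemma glue_pair1 : exists r, [/\ r \in im k, r != q, r != w, D <= (h r).+1 &
  (forall a b, a != b -> e2 a b) -> h r = D].
Proof.
have [b qb] := in_imP _ _ (pend_p Pq); have [z wz] := in_imP _ _ (pend_w Pq).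
have [y yb yz] := third_element b z n2.
have [||||r rw /andP[rq qr]] := @conn_nbr _ e1 (im k :\ w) q (k y).
- exact: pend_conn_D1 Pq.
- by rewrite in_setD1 pend_qw (pend_p Pq).
- by rewrite !inE imset_f // wz (inj_eq (pend_inj Pq)) yz.
- by rewrite qb (inj_eq (pend_inj Pq)) eq_sym.
have [rw' rk] := setD1P rw.
have hq := diam_q dq; exists r; split=> //.
  by rewrite -hq; apply: (diam_lip dq); rewrite S1.1.
move=> cpl; apply/eqP; rewrite eqn_leq (diam_max dq) /=.
have [m mw hm] := @arg_minnP _ r [pred a in im k :\ w] h rw.
have /setD1P[mw' mk] := mw.
have mp : m != p by apply: contraTneq mk => ->; apply: (pend_q Pq).
have [t tm ht] := diam_pred dq mp.
have tw : t = w.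
  apply/eqP/negPn/negP => tw.
  have [tk|tk] := boolP (t \in im k).
    have /= := hm t; rewrite !inE tw tk ht => /(_ isT); lia.
  by have := pend_out Pq mk mw' tk; rewrite S1.1 tm.
have : h q <= (h w).+1.
  apply: (diam_lip dq); rewrite qb wz (pend_iso Pq); apply: cpl.
  by apply: contraNneq pend_qw => zb; rewrite qb wz zb.
by have := hm r rw; rewrite hq ht tw; lia.
Qed.

Lemma pair_amalgam x y r : x != y -> r != q ->
  exists (V : finType) (e : rel V) (f1 : W1 -> V) (f2 : W2 -> V),
  [/\ simple_graph e, connected_graph e, gcover e e1 e2 f1 f2, f1 q = f2 x /\ f1 r = f2 y &
      im f1 :&: im f2 = [set f1 q; f1 r]].
Proof.
move=> xy rq.
have [|V [e [f1 [f2 [Se C E]]]]] := @amalgam W1 W2 e1 e2 [set x; y] (fun b => if b == x then q else r) S1 S2.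
  move=> a b; rewrite !inE => /orP[] /eqP-> /orP[] /eqP->; rewrite ?eqxx // eq_sym (negPf xy) => E.
    by rewrite E eqxx in rq.
  by rewrite E eqxx in rq.
have qx : f1 q = f2 x by apply/E; rewrite !inE eqxx.
have ry : f1 r = f2 y by apply/E; rewrite !inE eqxx orbT eq_sym (negPf xy).
have I : im f1 :&: im f2 = [set f1 q; f1 r].
  apply/setP => t; rewrite !inE; apply/andP/orP.
    case=> /imsetP[a _ ->] /imsetP[b _ ab]; have /E[_ ->] := ab.
    by case: ifP => _; [left|right].
  by case=> /eqP->; rewrite imset_f // ?qx ?ry imset_f.
exists V, e, f1, f2; split=> //; apply: conn_connected.
  by apply/card_gt0P; exists (f1 q).
have : f1 q \in im f1 :&: im f2 by rewrite I !inE eqxx.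
case/setIP=> h1 h2; apply: (cover_conn C Se.1 _ _ h1 h2); exact: connected_conn.
Qed.

(** Only [f1 w] joins the thickened end [K] to the rest, so in any decomposition the copy of [e2]
    lies in [K] or, up to [f1 w], outside it. The former leaves only the original decomposition; the
    latter forces the copy at the other end, where the two-vertex overlap creates a leaf. *)
Lemma thick_composable : composable e1 e2.
Proof.
have [x [y [s [xy sx sy cS H]]]] := glue_pair2.
have [r [rk rq rw hr hrD]] := glue_pair1.
have [V [e [f1 [f2 [Se ce C [fqx fry] I]]]]] := pair_amalgam xy rq.
have [[[s1 r1] [s2 r2]] [se re]] := (S1, S2, Se).
have cW1 := connected_conn c1; have cW2 := connected_conn c2.
have [i1 i2] := (cover_inj1 C, cover_inj2 C).
have nI : #|im f1 :&: im f2| = 2.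
  by rewrite I cards2 (inj_eq i1) eq_sym rq.
have cardV : #|V| + 2 = #|W1| + #|W2| by rewrite -nI (cover_card C).
have nk : #|im k| = #|W2| := pend_card Pq.
have nk' : #|im k'| = #|W2| := pend_card Pp.
have n12 : #|W2| < #|W1|.
  rewrite -nk -(cardsT W1); apply: proper_card; rewrite properT.
  by apply: contraNneq (pend_q Pq) => ->; rewrite inE.
have qk : q \in im k := pend_p Pq.
have pk : p \notin im k := pend_q Pq.
have qk' : q \notin im k' := pend_q Pp.
have qw : q != w := pend_pw Pq.
(* [r] can belong to the copy at [p] only as its root: otherwise the copy at [q], still connected
   without [w'], would bring [q] into it. *)
have rk' : r \in im k' -> r = w'.
  move=> rk'; apply/eqP/negPn/negP => rw'.
  have : im k :\ w' \subset im k'.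
    apply: (pend_side Pp _ _ _ rk'); first exact: (pend_conn_D1 _ Pq).
      by rewrite !inE eqxx.
    by rewrite in_setD1 rw' rk.
  move/subsetP/(_ q); rewrite in_setD1 qk andbT => /(_ _)/idP; rewrite (negPf qk').
  suff -> : q != w' by move/(_ isT).
  by apply: contraNneq qk' => ->; apply: pend_w Pp.
exists V, e; split=> //; first by move: cardV n12 n2; clear; lia.
apply: (cover_unique s1 s2 C) => g1 g2 C'.
have [j1 j2] := (cover_inj1 C', cover_inj2 C').
have nI' : #|im g1 :&: im g2| = 2.
  by move: (cover_card C'); rewrite -cardV; clear; lia.
suff [E1 E2] : im g1 = im f1 /\ im g2 = im f2.
  split=> //; first exact: (cover_edges_eq re s1 C C').
  by apply: (cover_edges_eq re s2 (coverC C) (coverC C')) => //; rewrite setIC.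
have [hf1 hf2] := (fun a b => @cover_hom1 _ _ _ _ _ _ _ _ a b C, fun a b => @cover_hom2 _ _ _ _ _ _ _ _ a b C).
have [hg1 hg2] := (fun a b => @cover_hom1 _ _ _ _ _ _ _ _ a b C', fun a b => @cover_hom2 _ _ _ _ _ _ _ _ a b C').
set A1 := im f1 in I nI *; set A2 := im f2 in I nI *.
set V1 := im g1 in nI' *; set V2 := im g2 in nI' *.
have A1A2 a : (f1 a \in A2) = (a == q) || (a == r).
  have -> : (f1 a \in A2) = (f1 a \in A1 :&: A2) by rewrite inE (imset_f f1).
  by rewrite I !inE !(inj_eq i1).
have edge1 u a : e (f1 a) u -> (a != q) && (a != r) -> exists2 b, u = f1 b & e1 a b.
  rewrite (cover_edge C) -negb_or -A1A2 => /orP[] /edgesP[a' [b [Ea -> ab]]].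
    by rewrite (i1 _ _ Ea); exists b.
  by rewrite Ea imset_f.
(* [B] is the old copy at [q], seen in the glued graph; [K] is this end thickened by the new copy
   [A2]; [S] consists of the new vertices. *)
set B := f1 @: im k; pose K := B :|: A2.
pose S := f2 @: (setT :\ y :\ x).
have inB a : (f1 a \in B) = (a \in im k) by rewrite mem_imset.
have inS b : (f2 b \in S) = (b != x) && (b != y) by rewrite mem_imset // !inE andbT.
have SA1 u : u \in S -> u \notin A1.
  case/imsetP=> b; rewrite !inE andbT => /andP[bx yb] ->; apply/negP => bA1.
  have : f2 b \in A1 :&: A2 by rewrite inE bA1 imset_f.
  by rewrite I !inE fqx fry !(inj_eq i2) (negPf bx) (negPf yb).
have BA1 u : u \in B -> u \in A1 by case/imsetP=> a _ ->; apply: imset_f.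
have A2S : A2 = S :|: [set f1 q; f1 r].
  apply/setP => u; apply/idP/idP => [/in_imP[b ->]|]; rewrite !inE.
    by rewrite inS fqx fry !(inj_eq i2); case: (b == x); case: (b == y).
  by case/or3P=> [/imsetP[b _ ->]|/eqP->|/eqP->]; rewrite ?imset_f // A1A2 eqxx ?orbT.
have wA2 : f1 w \notin A2 by rewrite A1A2 negb_or eq_sym qw eq_sym rw.
have wB : f1 w \in B by rewrite inB (pend_w Pq).
have wK : f1 w \in K by rewrite inE wB.
have cSe : conn e S by apply: conn_im cS => a b _ _; apply: hf2.
have cBk u : conn e (B :\ u).
  apply: (conn_im_D1 (eW := e1)) => //; first exact: (pend_conn cW2 Pq).
  by move=> v; apply: (pend_conn_D1 v Pq).
have cV1 : conn e V1 by apply: conn_im cW1 => a b _ _; apply: hg1.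
have cV2 u : conn e (V2 :\ u) by apply: (conn_im_D1 (eW := e2)).
have Kout u t : u \in K -> u != f1 w -> t \notin K -> ~~ e u t.
  move=> uK uw; rewrite inE negb_or => /andP[tB tA2]; apply/negP => ut.
  have : e t u by rewrite se.
  have /in_imP[b tb] : t \in A1 by have := cover_in (coverC C) tA2.
  rewrite tb => /edge1[]; first by rewrite -negb_or -A1A2 -tb.
  move=> a ua ba; have ak : a \in im k.
    move: uK; rewrite inE ua inB A1A2 => /or3P[//|/eqP->//|/eqP->//].
  have aw : a != w by apply: contraNneq uw => <-; rewrite ua.
  have bk : b \notin im k by rewrite -inB -tb.
  by have := pend_out Pq ak aw bk; rewrite s1 ba.
(* Each glued vertex has a neighbour in [S] and, by [Bnbr], another in [A1] outside [A2]. Since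
   every edge lies inside one part, such neighbours decide to which parts the glued vertices
   belong. *)
have Snbr u : u \in [set f1 q; f1 r] -> exists2 t, t \in S & e u t.
  have nb a b : a != b -> s != a -> s != b -> exists2 z, (z != a) && (z != b) & e2 a z.
    move=> ab sa sb; have [|||z] := @conn_nbr _ e2 (setT :\ b) a s (nc b).
    - by rewrite !inE ab.
    - by rewrite !inE sb.
    - by rewrite eq_sym.
    by rewrite !inE andbT => zb /andP[za az]; exists z; rewrite // za.
  rewrite !inE => /orP[] /eqP->.
    by have [z zz xz] := nb x y xy sx sy; exists (f2 z); rewrite ?inS // fqx hf2.
  by have [|z zz yz] := nb y x _ sy sx; [rewrite eq_sym | exists (f2 z); rewrite ?inS 1?andbC // fry hf2].
have Bnbr u : u \in [set f1 q; f1 r] -> exists2 t, t \in A1 & (t \notin A2) && e u t.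
  have nb a b : a \in im k -> a != b -> w != a -> w != b -> exists2 z, (z != a) && (z != b) & e1 a z.
    move=> ak ab wa wb; have [|||z] := @conn_nbr _ e1 (im k :\ b) a w (pend_conn_D1 b Pq).
    - by rewrite in_setD1 ab.
    - by rewrite in_setD1 wb (pend_w Pq).
    - by rewrite eq_sym.
    by rewrite in_setD1 => /andP[zb _] /andP[za az]; exists z; rewrite // za.
  rewrite !inE => /orP[] /eqP->.
    have [||||z zz qz] := nb q r; rewrite // 1?eq_sym //.
    by exists (f1 z); rewrite ?imset_f // A1A2 negb_or zz hf1.
  have [||||z zz rz] := nb r q; rewrite // 1?eq_sym //.
  by exists (f1 z); rewrite ?imset_f // A1A2 negb_or [_ && (z != r)]andbC zz hf1.
have pB : f1 p \notin B by rewrite inB.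
have pK : f1 p \notin K.
  rewrite inE negb_or pB /= A1A2 negb_or; apply/andP; split; by apply: contraNneq pk => ->.
have nB : #|B| = #|W2| by rewrite card_imset.
have nA2 : #|A2| = #|W2| by apply: card_im.
have nA1 : #|A1| = #|W1| by apply: card_im.
have nV1 : #|V1| = #|W1| by apply: card_im.
have nV2 : #|V2| = #|W2| by apply: card_im.
have BIA2 : B :&: A2 = A1 :&: A2.
  apply/setP => u; rewrite !inE; apply/andP/andP => -[uB uA2]; split=> //; first exact: BA1.
  have : u \in A1 :&: A2 by rewrite inE uB.
  by rewrite I !inE => /orP[] /eqP->; rewrite inB.
have nK : #|K| + 2 = #|W2| + #|W2|.
  by have := cardsUI B A2; rewrite BIA2 nI nB nA2.
have nR : #|~: K| + #|W2| = #|W1| by move: (cardsC K) nK cardV n2; clear; lia.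
have out2 u : u \notin V1 -> u \in V2 := cover_in C'.
have out1 u : u \notin V2 -> u \in V1 := cover_in (coverC C').
have cross u t : u \notin V2 -> t \notin V1 -> e u t -> False.
  by move=> u2 t1; apply/negP; apply: cover_cross C' _ _.
have [|V2K|V2K] := @conn_side _ e (V2 :\ f1 w) K (cV2 _).
- by move=> u t /setD1P[uw _] _ uK; apply: Kout.
- (* The copy V2 of G2 lies in the thickened end K, which leaves only the decomposition (A1, A2). *)
  have {}V2K : V2 \subset K.
    apply/subsetP => u u2; have [->//|uw] := eqVneq u (f1 w).
    by apply: (subsetP V2K); rewrite in_setD1 uw.
  have RV1 u : u \notin K -> u \in V1 by move=> uK; apply/out1/(contra _ uK)/(subsetP V2K).
  (* Without [f1 w], the connected set [V1] would lie inside [K] or outside it. But it contains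
     [f1 p], which is not in [K], and is too large to fit outside. *)
  have wV1 : f1 w \in V1.
    apply/negPn/negP => wn; have [|sub|sub] := @conn_side _ e V1 K cV1.
    + by move=> u t u1 _ uK; apply: Kout => //; apply: contraNneq wn => <-.
    + by move: (subsetP sub _ (RV1 _ pK)); rewrite (negPf pK).
    have /subset_leq_card : V1 \subset ~: K by apply/subsetP => u /sub; rewrite in_setC.
    by move: nR n2; rewrite nV1; clear; lia.
  (* [V1] contains everything outside [K], so inside [K] it has exactly as many vertices as a copy
     of [e2]. *)
  have nVK : #|V1 :&: K| = #|W2|.
    have := cardsID K V1; have -> : V1 :\: K = ~: K.
      by apply/setP => u; rewrite in_setD in_setC; have [|/RV1->] := boolP (u \in K).
    by move: nR; rewrite nV1; clear; lia.
  have sideV (X : {set V}) : conn e X -> (forall u, u \in X -> u \notin V1 :&: V2) ->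
      X \subset V1 \/ X \subset V2.
    move=> cX dX; apply: (cover_side C' cX) => u /dX.
    by rewrite inE negb_and => /orP[/negPf->|].
  (* If [S] avoids the overlap, it lies in one part and brings [A2] with it. In [V1], [A2] would
     equal [V1 :&: K], which contains [f1 w]; so [A2] is [V2]. *)
  have [dS|] := boolP [forall u in S, u \notin V1 :&: V2].
    have A2in (X : {set V}) : S \subset X -> (forall u t, t \in S -> e u t -> u \in X) -> A2 \subset X.
      move=> SX nX; apply/subsetP => u; rewrite A2S in_setU => /orP[/(subsetP SX)//|/Snbr[t tS ut]].
      exact: nX ut.
    have dS' u : u \in S -> u \notin V1 :&: V2 by move/forall_inP: dS; apply.
    have [SV|SV] := sideV S cSe dS'.
      have A2V1 : A2 \subset V1.
        apply: A2in => // u t tS ut; apply/negPn/negP => u1.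
        apply: (@cross t u); rewrite // 1?se //.
        by have := dS' t tS; rewrite inE (subsetP SV t tS).
      have E : A2 = V1 :&: K.
        by apply/eqP; rewrite eqEcard nVK nA2 leqnn subsetI A2V1 subsetUr.
      by case/negP: wA2; rewrite E inE wV1.
    have A2V2 : A2 = V2.
      apply/eqP; rewrite eqEcard nA2 nV2 leqnn andbT; apply: A2in => // u t tS ut.
      apply/negPn/negP => u2; apply: (@cross u t) => //.
      by have := dS' t tS; rewrite inE (subsetP SV t tS) andbT.
    split=> //; apply/eqP; rewrite eq_sym eqEcard nA1 nV1 leqnn andbT.
    apply/subsetP => u uA1; have [uA2|uA2] := boolP (u \in A2); last by apply: out1; rewrite -A2V2.
    have : u \in A1 :&: A2 by rewrite inE uA1.
    rewrite I => /Bnbr[t tA1 /andP[tA2 ut]]; apply/negPn/negP => u1.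
    by apply: (@cross t u); rewrite // 1?se // -A2V2.
  (* Otherwise the overlap consists of some [u] in [S] and a vertex [t]. Then [B :\ t] lies in one
     part, so by size [B] equals [V1 :&: K] or [V2]; both contain [u], which is not in [B]. *)
  case/forall_inPn=> u uS; rewrite negbK => u12.
  have [t tu E12] := setU1_two u12 nI'.
  have t12 : t \in V1 :&: V2 by rewrite E12 !inE eqxx orbT.
  have uB : u \notin B by apply: contra (SA1 u uS); apply: BA1.
  have Bin (X : {set V}) : B :\ t \subset X -> t \in X -> B \subset X.
    move=> sub tX; apply/subsetP => z zB; have [->//|zt] := eqVneq z t.
    by apply: (subsetP sub); rewrite in_setD1 zt.
  have [t1 t2] := setIP t12; have [u1 u2] := setIP u12.
  have [|sub|sub] := sideV (B :\ t) (cBk t).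
  + move=> z /setD1P[zt zB]; rewrite E12 !inE negb_or zt andbT.
    by apply: contraNneq uB => <-.
  + have E : B = V1 :&: K.
      by apply/eqP; rewrite eqEcard nVK nB leqnn subsetI (Bin _ sub t1) subsetUl.
    by case/negP: uB; rewrite E inE u1 (subsetP V2K).
  have E : B = V2 by apply/eqP; rewrite eqEcard nB nV2 leqnn (Bin _ sub t2).
  by rewrite E u2 in uB.
(* Now V2 avoids K, up to w; then V2 is the copy B' of G2 at the other end. *)
have KV1' u : u \in K -> u != f1 w -> u \in V1.
  by move=> uK uw; apply: out1; apply: contraL uK => u2; apply: V2K; rewrite in_setD1 uw.
have wV1 : f1 w \in V1.
  have [t tB /andP[tw wt]] : exists2 t, t \in B & (t != f1 w) && e (f1 w) t.
    have wq : w != q by rewrite eq_sym.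
    have [z zk /andP[zw wz]] := conn_nbr (pend_conn cW2 Pq) (pend_w Pq) qk wq.
    by exists (f1 z); rewrite ?inB // (inj_eq i1) zw hf1.
  apply/negPn/negP => w1; apply: (@cross t (f1 w)); rewrite // 1?se //.
  by apply/negP => t2; have := V2K t; rewrite in_setD1 tw t2 inE tB => /(_ isT).
have KV1 u : u \in K -> u \in V1.
  by move=> uK; have [->|] := eqVneq u (f1 w); last exact: KV1'.
have pV1 : f1 p \notin V1.
  (* New vertices get height [D.+1], except that neighbours of [y] get [D] when [h r] falls short of
     [D]. The height of [s] is always [D.+1]: it is not adjacent to [y], or [e2] is complete and
     [h r = D]. *)
  pose h2 b := if (h r == D) || ~~ e2 y b then D.+1 else D.
  have [Ph2 [Ph2E _]] := @extend_fun V W2 f2 h2 (fun=> 0) i2.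
  have [Phi [Ph1 Ph2']] := @extend_fun V W1 f1 h Ph2 i1.
  have hm := diam_max dq; have hq := diam_q dq.
  have PhS b : f2 b \notin A1 -> Phi (f2 b) = h2 b by move=> bA; rewrite Ph2' // Ph2E.
  have h2D b : D <= h2 b <= D.+1 by rewrite /h2; case: ifP => _; rewrite leqnn leqnSn.
  have Lip u t : e u t -> Phi t <= (Phi u).+1.
    rewrite (cover_edge C) => /orP[] /edgesP[a [b [-> -> ab]]].
      by rewrite !Ph1; apply: (diam_lip dq).
    have [aA|aA] := boolP (f2 a \in A1); have [bA|bA] := boolP (f2 b \in A1); last first.
    + by rewrite !PhS //; move: (h2D a) (h2D b); clear; lia.
    + have [a' Ea] := in_imP _ _ bA; rewrite Ea Ph1 PhS //; move: (hm a') (h2D a); clear; lia.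
    + have : f2 a \in A1 :&: A2 by rewrite inE aA imset_f.
      rewrite (PhS b bA) I !inE => /orP[] /eqP Ea; rewrite Ea Ph1; first by move: (h2D b); rewrite hq; clear; lia.
      have ay : a = y by apply: i2; rewrite Ea.
      by rewrite /h2 -ay ab orbF; case: eqP => [->|_] //; move: hr; clear; lia.
    have inq d : f2 d \in A1 -> D <= (Phi (f2 d)).+1 /\ Phi (f2 d) <= D.
      move=> dA; have : f2 d \in A1 :&: A2 by rewrite inE dA imset_f.
      by rewrite I !inE => /orP[] /eqP->; rewrite Ph1 ?hq; split.
    by move: (inq a aA) (inq b bA) => [+ _] [_]; clear; lia.
  apply/negP => /in_imP[p' pE].
  have sA2 : f2 s \in A2 by apply: imset_f.
  have sS : f2 s \in S by rewrite inS sx sy.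
  have /KV1/in_imP[s' sE] : f2 s \in K by rewrite inE sA2 orbT.
  have [n nD wn] := diam_le dq p' s'.
  have := simple_walk_im (e := e) (f := g1) hg1 wn.
  rewrite -pE -sE => /(walk_lip Lip); rewrite Ph1 (diam_p dq) PhS ?SA1 //.
  have -> : h2 s = D.+1 by rewrite /h2; case: H => [->|/hrD->]; rewrite ?eqxx ?orbT.
  by move: nD; clear; lia.
pose B' := f1 @: im k'.
have inB' a : (f1 a \in B') = (a \in im k') by rewrite mem_imset.
have B'out u t : u \in B' -> u != f1 w' -> t \notin B' -> ~~ e u t.
  case/imsetP=> a ak ->; rewrite (inj_eq i1) => aw tB; apply/negP => /edge1[].
    apply/andP; split; first by apply: contraNneq qk' => <-.
    by apply: contraNneq aw => ar; rewrite -rk' -?ar.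
  move=> b tb; apply/negP; apply: (pend_out Pp ak aw).
  by rewrite -inB' -tb.
have nB' : #|B'| = #|W2| by rewrite card_imset.
have w'B' : f1 w' \in B' by rewrite inB' (pend_w Pp).
have pw' : p != w' := pend_pw Pp.
have V2B' : V2 = B'.
  apply/eqP; rewrite eqEcard nB' nV2 leqnn andbT.
  have [|sub|/(_ (f1 p))] := @conn_side _ e (V2 :\ f1 w') B' (cV2 _).
  - by move=> u t /setD1P[uw _] _ uB; apply: B'out.
  - apply/subsetP => u u2; have [->//|uw] := eqVneq u (f1 w').
    by apply: (subsetP sub); rewrite in_setD1 uw.
  rewrite in_setD1 (inj_eq i1) pw' inB' (pend_p Pp) out2 //.
  by move/(_ isT).
(* V1 meets B' in its root w' and in one more vertex z, whose only neighbour in V1 is w'. *)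
have [z z12 zw] : exists2 z, z \in V1 :&: V2 & z != f1 w'.
  have : 0 < #|(V1 :&: V2) :\ f1 w'|.
    by move: (cardsD1 (f1 w') (V1 :&: V2)); rewrite nI'; case: (_ \in _); clear; lia.
  by case/card_gt0P=> z /setD1P[zw z12]; exists z.
have [z1 z2] := setIP z12.
have w'1 : f1 w' \in V1.
  apply/negPn/negP => wn; have [|/subsetP/(_ (f1 q))|/(_ z z1)] := @conn_side _ e V1 B' cV1.
  - by move=> u t u1 _ uB; apply: B'out => //; apply: contraNneq wn => <-.
  - by rewrite inB' (negPf qk') KV1 ?inE ?inB ?qk // => /(_ isT).
  by rewrite -V2B' z2.
have w'12 : f1 w' \in V1 :&: V2 by rewrite inE w'1 V2B'.
have [z' z'w E12] := setU1_two w'12 nI'.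
have zz' : z' = z by move: z12; rewrite E12 !inE (negPf zw) => /eqP.
have zN t : t \in V1 -> e z t -> t = f1 w'.
  move=> t1 zt; have tB : t \in B'.
    by apply: contraTT zt => /B'out; apply; rewrite -?V2B'.
  have : t \in V1 :&: V2 by rewrite inE t1 V2B'.
  rewrite E12 zz' !inE => /orP[] /eqP // tz.
  by rewrite tz re in zt.
have notlow a : a \in im k' -> ~~ low a by apply: pend_low Pp.
(* Low vertices avoid both pendant copies, hence stay low in [V1]; by counting, both embeddings have
   the same image of low vertices. So [z], a leaf of [V1], would come from a low vertex of [e1] in
   the copy [im k']. *)
have sub : f1 @: [set a | low a] \subset g1 @: [set a | low a].
  apply/subsetP => u /imsetP[a]; rewrite inE => la ->.
  have ak' : a \notin im k' by apply: contraL la; apply: notlow.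
  have ak : a \notin im k by apply: contraL la; apply: (pend_low Pq).
  have aqr : (a != q) && (a != r) by apply/andP; split; apply: contraNneq ak => ->.
  have /in_imP[a' Ea] : f1 a \in V1 by apply: out1; rewrite V2B' inB'.
  rewrite Ea imset_f // inE; apply/forallP => b; apply/forallP => b'.
  apply/implyP => /andP[/hg1 + /hg1]; rewrite -Ea => /edge1/(_ aqr)[t bt at1] /edge1/(_ aqr)[t' bt' at2].
  have /forallP/(_ t)/forallP/(_ t')/implyP := la; rewrite at1 at2 => /(_ isT)/eqP tt.
  by rewrite -(inj_eq j1) bt bt' tt.
have E : f1 @: [set a | low a] = g1 @: [set a | low a].
  by apply/eqP; rewrite eqEcard sub !card_imset //= leqnn.
have [z0 zE] := in_imP _ _ z1.
have : z \in f1 @: [set a | low a].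
  rewrite E zE imset_f // inE; apply/forallP => b; apply/forallP => b'.
  apply/implyP => /andP[/hg1 + /hg1]; rewrite -zE => zb zb'.
  by rewrite -(inj_eq j1) (zN _ _ zb) ?imset_f // (zN _ _ zb') ?imset_f.
case/imsetP=> a; rewrite inE => la Ea.
by rewrite (negPf (notlow a _)) // -inB' -Ea -V2B' in la.
Qed.
End Thick.

(** * Attaching an edge *)

Section PendantEdge.
Variables (W1 W2 : finType) (e1 : rel W1) (e2 : rel W2).
Hypotheses (S1 : simple_graph e1) (S2 : simple_graph e2).
Hypotheses (c1 : connected_graph e1) (c2 : connected_graph e2).
Hypotheses (n1 : 2 < #|W1|) (n2 : #|W2| = 2).

Definition deg (V : finType) (e : rel V) x := #|[set y | e x y]|.

Lemma deg_pos a : 0 < deg e1 a.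
Proof.
have [z za _] := third_element a a n1.
have [|b _ /andP[_ ab]] := conn_nbr (connected_conn c1) (in_setT a) (in_setT z).
  by rewrite eq_sym.
by apply/card_gt0P; exists b; rewrite inE.
Qed.

Record pend_edge (V : finType) (e : rel V) (f : W1 -> V) u y : Prop := PendEdge {
  pe_inj : injective f;
  pe_im : forall x, (x \in im f) = (x != y);
  pe_ind : forall a b, e (f a) (f b) = e1 a b;
  pe_new : forall a, e (f a) y = (a == u) }.

(** A second decomposition removes an edge whose outer end is a leaf of the sum other than [y],
    hence a leaf [l] of [e1]; what remains is again a copy of [e1]. *)
Lemma pend_edge_sum u : exists (V : finType) (e : rel V) (f : W1 -> V) y,
  [/\ simple_graph e, connected_graph e, #|V| = #|W1|.+1, pend_edge e f u y &
   ~ uniquely_decomposable e e1 e2 -> exists l (g : W1 -> V),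
     [/\ l != u, injective g, forall x, (x \in im g) = (x != f l),
         forall a b, e (g a) (g b) = e1 a b & exists t, forall b, e1 l b = (b == t)]].
Proof.
have [v [v' [vv' W2E]]] : exists v v', v != v' /\ forall b : W2, (b == v) || (b == v').
  have /card_gt0P[v _] : 0 < #|W2| by rewrite n2.
  have [|v' vv' E] := @setU1_two _ [set: W2] v (in_setT v); first by rewrite cardsT.
  exists v, v'; rewrite eq_sym; split=> // b; have := in_setT b; by rewrite E !inE.
have [s2 r2] := S2; have [s1 r1] := S1.
have e2vv' : e2 v v'.
  have [b _ /andP[bv]] := conn_nbr (connected_conn c2) (in_setT v) (in_setT v') vv'.
  by have := W2E b; rewrite (negPf bv) /= => /eqP->.
have [V [e [f [f2 [Se ce C I fuv]]]]] := point_amalgam S1 S2 c1 c2 u v.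
have [se re] := Se.
have cardV : #|V|.+1 = #|W1| + #|W2| by rewrite -(cover_card C) I cards1 addn1.
have [i1 i2] := (cover_inj1 C, cover_inj2 C).
have ind1 := cover_one_point_induced re C I.
have ind2 : forall a b, e (f2 a) (f2 b) = e2 a b.
  by apply: (cover_one_point_induced re (coverC C)); rewrite setIC; apply: I.
have yN : f2 v' \notin im f.
  apply/negP => yf; have : f2 v' \in im f :&: im f2 by rewrite inE yf imset_f.
  by rewrite I inE fuv => /eqP/i2 E; rewrite E eqxx in vv'.
have imf x : (x \in im f) = (x != f2 v').
  have [->|xy] := eqVneq x (f2 v'); first exact: negPf.
  apply/negPn/negP => xf; have /in_imP[b xb] := cover_in C xf.
  have := W2E b => /orP[] /eqP E; last by rewrite xb E eqxx in xy.
  by rewrite xb E -fuv imset_f in xf.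
have new a : e (f a) (f2 v') = (a == u).
  have [->|au] := eqVneq a u; first by rewrite fuv ind2.
  apply/negP; rewrite (cover_edge C) => /orP[] /edgesP[a' [b' [Ea Eb ab]]].
    by rewrite Eb imset_f in yN.
  have : f a \in im f :&: im f2 by rewrite inE imset_f // Ea imset_f.
  by rewrite I inE (inj_eq i1) (negPf au).
exists V, e, f, (f2 v'); split=> //; first by move: cardV; rewrite n2; clear; lia.
move=> nU; apply: NNPP => no; apply: nU; apply: (cover_unique s1 s2 C) => g1 g2 C'.
have /eqP/cards1P[w Iw] : #|im g1 :&: im g2| = 1.
  by move: (cover_card C'); rewrite -cardV; clear; lia.
have [j1 j2] := (cover_inj1 C', cover_inj2 C').
have jnd1 := cover_one_point_induced re C' Iw.
have jnd2 : forall a b, e (g2 a) (g2 b) = e2 a b.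
  by apply: (cover_one_point_induced re (coverC C')); rewrite setIC; apply: Iw.
have /setIP[w1 w2] : w \in im g1 :&: im g2 by rewrite Iw inE.
have [L Lw V2E] := setU1_two w2 (etrans (card_im j2) n2).
have L2 : L \in im g2 by rewrite V2E !inE eqxx orbT.
have L1 : L \notin im g1.
  by apply: contra Lw => L1; rewrite -in_set1 -Iw inE L1.
have img1 x : (x \in im g1) = (x != L).
  have [->|xL] := eqVneq x L; first exact: negPf.
  apply/negPn/negP => x1; have := cover_in C' x1.
  by rewrite V2E !inE (negPf xL) orbF => /eqP xw; rewrite xw w1 in x1.
have ewL : e w L.
  move: w2 L2 Lw => /in_imP[b ->] /in_imP[b' ->]; rewrite (inj_eq j2) jnd2 => bb.
  have := W2E b; have := W2E b'; case/orP=> /eqP Eb' /orP[] /eqP Eb; move: bb; rewrite Eb Eb' ?eqxx // ?e2vv' //.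
  by rewrite s2 e2vv'.
have [Ly|Ly] := eqVneq L (f2 v').
  have E1 : im g1 = im f by apply/setP => x; rewrite img1 imf Ly.
  have E2 : im g2 = im f2.
    have wu : w = f u.
      have /in_imP[a wa] : w \in im f by rewrite -E1.
      by move: ewL; rewrite wa Ly new => /eqP->.
    by apply/eqP; rewrite eqEcard !card_im // leqnn andbT V2E wu Ly fuv subUset !sub1set !imset_f.
  by rewrite (edges_induced i1 ind1) (edges_induced i2 ind2) (edges_induced j1 jnd1)
    (edges_induced j2 jnd2) E1 E2.
have /in_imP[l Ll] : L \in im f by rewrite imf.
have LN z : e L z = (z == w).
  have [->|zw] := eqVneq z w; first by rewrite se.
  apply/negP => Lz; have z2 : z \notin im g2.
    rewrite V2E !inE negb_or zw /=; apply: contraTneq Lz => ->; by rewrite re.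
  by have := cover_cross C' z2 L1; rewrite se Lz.
(* [w] is the only neighbour of [L]; if it were the new vertex, [l] would have no neighbour in [e1].
   This also yields [l != u]. *)
have wy : w != f2 v'.
  apply/eqP => wy; have /card_gt0P[b] := deg_pos l; rewrite inE -ind1 -Ll LN wy => /eqP E.
  by rewrite -E imset_f in yN.
have /in_imP[t wt] : w \in im f by rewrite imf.
case: no; exists l, g1; split=> //.
- by apply: contraNneq wy => lu; rewrite eq_sym -LN Ll lu new eqxx.
- by move=> x; rewrite img1 Ll.
by exists t => b; rewrite -ind1 -Ll LN wt (inj_eq i1).
Qed.

Section Alternative.
Variables (V : finType) (e : rel V) (f g : W1 -> V) (u l : W1) (y : V).
Hypotheses (Se : simple_graph e) (PE : pend_edge e f u y) (lu : l != u).
Hypotheses (gI : injective g) (img : forall x, (x \in im g) = (x != f l)).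
Hypothesis ind : forall a b, e (g a) (g b) = e1 a b.

Lemma nbr_f a : [set z | e (f a) z] = f @: [set b | e1 a b] :|: (if a == u then [set y] else set0).
Proof.
apply/setP => z; rewrite !inE; have [->|zy] := eqVneq z y.
  rewrite (pe_new PE); case: eqP => _; rewrite ?inE ?eqxx ?orbT //.
  rewrite orbF; apply/esym/negP => /imsetP[b _ yb].
  by have := pe_im PE y; rewrite eqxx yb imset_f.
have /in_imP[b zb] : z \in im f by rewrite (pe_im PE).
rewrite zb (pe_ind PE) (mem_imset _ _ (pe_inj PE)) inE; case: ifP => _; rewrite !inE ?orbF //.
by rewrite -zb (negPf zy) orbF.
Qed.

Lemma card_nbr_f a : #|[set z | e (f a) z]| = deg e1 a + (a == u).
Proof.
rewrite nbr_f cardsU (card_imset _ (pe_inj PE)) -/(deg e1 a).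
have -> : f @: [set b | e1 a b] :&: (if a == u then [set y] else set0) = set0.
  apply/setP => z; rewrite !inE; case: ifP => _; rewrite !inE ?andbF //.
  apply/negP => /andP[/imsetP[b _ ->] /eqP yb].
  by have := pe_im PE y; rewrite eqxx -yb imset_f.
by rewrite cards0 subn0; case: eqP => _; rewrite ?cards1 ?cards0.
Qed.

Lemma deg_g a : deg e1 a = #|[set z in im g | e (g a) z]|.
Proof.
rewrite /deg -(card_imset (mem [set b | e1 a b]) gI); apply: eq_card => z; rewrite !inE.
apply/imsetP/andP => [[b + ->]|[/in_imP[b ->]]].
  by rewrite inE ind imset_f.
by rewrite ind => ab; exists b; rewrite ?inE.
Qed.

(** The new leaf raises the degree of [u] above the maximum, and deleting a vertex not adjacent to
    [u] does not lower it again; yet the rest is a copy of [e1]. *)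
Lemma alt_max_nbr : (forall b, deg e1 b <= deg e1 u) -> ~~ e1 l u -> False.
Proof.
move=> mx nlu; have /in_imP[a Ea] : f u \in im g.
  by rewrite img (inj_eq (pe_inj PE)) eq_sym.
have := mx a; rewrite deg_g -Ea.
have -> : [set z in im g | e (f u) z] = [set z | e (f u) z].
  apply/setP => z; rewrite !inE img; have [->|//] := eqVneq z (f l).
  by rewrite (pe_ind PE) S1.1 (negPf nlu).
by rewrite card_nbr_f eqxx; clear; lia.
Qed.

(* The new leaf y of the sum is further away from the vertices of degree at least 3 than any leaf of G1. *)
Lemma alt_far_leaf T : deg e1 u = 1 ->
  (forall n, n < T -> ~~ [exists b, (2 < deg e1 b) && walk e1 n u b]) ->
  (forall v, deg e1 v == 1 -> exists2 n, n <= T & [exists b, (2 < deg e1 b) && walk e1 n v b]) ->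
  False.
Proof.
move=> du far near; have yf : y \notin im f by rewrite (pe_im PE) eqxx.
have /in_imP[y' Ey] : y \in im g.
  by rewrite img; apply: contraNneq yf => ->; rewrite imset_f.
(* [y] keeps its only neighbour [f u] because [l != u], so it is a leaf of the remaining copy. *)
have dy : deg e1 y' = 1.
  rewrite deg_g -Ey; apply/eqP/cards1P; exists (f u); apply/setP => z; rewrite !inE.
  have [->|zu] := eqVneq z (f u).
    by rewrite img (inj_eq (pe_inj PE)) eq_sym lu Se.1 (pe_new PE) eqxx.
  apply/negP => /andP[_]; rewrite Se.1; have [->|zy] := eqVneq z y; first by rewrite Se.2.
  have /in_imP[a za] : z \in im f by rewrite (pe_im PE).
  by rewrite za (pe_new PE) => /eqP au; rewrite za au eqxx in zu.
have [n nT /existsP[b /andP[db wb]]] := near y' (introT eqP dy).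
have [h [h0 hw hl _]] := dist_exists u c1.
(* [k] is the distance from [y]: one more than the distance from [u] on the old vertices. *)
have [k [k1 k2]] := @extend_fun V W1 f (fun a => (h a).+1) (fun=> 0) (pe_inj PE).
have Lip x z : e x z -> k z <= (k x).+1.
  have [->|zy] := eqVneq z y; first by rewrite (k2 y yf).
  have /in_imP[b' ->] : z \in im f by rewrite (pe_im PE).
  have [->|xy] := eqVneq x y; first by rewrite Se.1 (pe_new PE) k1 => /eqP->; rewrite h0.
  have /in_imP[a ->] : x \in im f by rewrite (pe_im PE).
  by rewrite (pe_ind PE) !k1 ltnS; apply: hl.
have hg a c : e1 a c -> e (g a) (g c) by rewrite ind.
have := walk_lip Lip (simple_walk_im hg wb); rewrite -Ey (k2 y yf) add0n => kb.
have gby : g b != y.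
  by rewrite Ey (inj_eq gI); apply: contraTneq db => ->; rewrite dy.
have /in_imP[a Ea] : g b \in im f by rewrite (pe_im PE).
rewrite Ea k1 in kb; have /far/negP[] := leq_trans kb nT.
apply/existsP; exists a; rewrite (hw a).1 andbT.
(* [u] has degree only 2 in the sum, so a vertex of degree at least 3 there differs from [u] and has
   the same degree in [e1]. *)
have : deg e1 b <= deg e1 a + (a == u).
  rewrite -card_nbr_f deg_g Ea; apply/subset_leq_card/subsetP => z.
  by rewrite !inE => /andP[].
move: db; have [->|_] := eqVneq a u; rewrite ?du; clear; lia.
Qed.
End Alternative.

Lemma sum_composable u : (forall (V : finType) (e : rel V) (f g : W1 -> V) l y,
    simple_graph e -> pend_edge e f u y -> l != u -> injective g ->
    (forall x, (x \in im g) = (x != f l)) -> (forall a b, e (g a) (g b) = e1 a b) ->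
    deg e1 l = 1 -> False) -> composable e1 e2.
Proof.
move=> K; have [V [e [f [y [Se ce cV PE H]]]]] := pend_edge_sum u.
exists V, e; split=> //; first by move: n1; rewrite cV n2; clear; lia.
apply: NNPP => /H[l [g [lu gI img ind [t lt]]]].
apply: (K V e f g l y) => //; apply/eqP/cards1P; exists t.
by apply/setP => b; rewrite !inE lt.
Qed.

Lemma max_deg_composable u : (forall b, deg e1 b <= deg e1 u) ->
  (forall l, e1 l u -> deg e1 l != 1) -> composable e1 e2.
Proof.
move=> mx nl; apply: (@sum_composable u) => V e f g l y Se PE lu gI img ind dl.
apply: (alt_max_nbr PE lu gI img ind mx).
by apply: contraTN (introT eqP dl) => /nl.
Qed.

Lemma far_leaf_composable l0 b0 : deg e1 l0 = 1 -> 2 < deg e1 b0 -> composable e1 e2.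
Proof.
move=> dl db.
have [||T [u [/eqP du far near]]] := @least_uniform_bound W1 (fun v => deg e1 v == 1)
    (fun v n => [exists b, (2 < deg e1 b) && walk e1 n v b]).
- by exists l0; rewrite dl.
- move=> v _; have [n wn] := walk_exists v b0 c1.
  by exists n; apply/existsP; exists b0; rewrite db.
apply: (@sum_composable u) => V e f g l y Se PE lu gI img ind _.
exact: (alt_far_leaf Se PE lu gI img ind du far near).
Qed.

Lemma deg1P a : deg e1 a = 1 -> exists t, forall b, e1 a b = (b == t).
Proof.
move/eqP/cards1P=> [t Et]; exists t => b.
by have /setP/(_ b) := Et; rewrite !inE.
Qed.

Lemma deg2P a b : deg e1 a = 2 -> e1 a b -> exists2 c, c != b & forall z, e1 a z = (z == b) || (z == c).
Proof.
move=> da ab; have [|c cb E] := @setU1_two _ [set z | e1 a z] b _ da; first by rewrite inE.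
by exists c => // z; have /setP/(_ z) := E; rewrite !inE.
Qed.


Lemma all_closed (X : {set W1}) a : a \in X ->
  (forall x y, x \in X -> e1 x y -> y \in X) -> X = setT.
Proof.
move=> aX cl; apply/eqP; rewrite -subTset.
by apply: (connP _ _ (connected_conn c1) _ a) => // x y _ _; apply: cl.
Qed.
End PendantEdge.

(** * Recognition of short paths *)

Lemma path_iso (W : finType) (e : rel W) (x0 : W) (s : seq W) n :
  uniq s -> size s = n.+1 -> (forall x, x \in s) ->
  (forall i j, i < n.+1 -> j < n.+1 ->
     e (nth x0 s i) (nth x0 s j) = (i.+1 == j) || (j.+1 == i)) ->
  graph_iso e (path_rel n).
Proof.
move=> us sz sx H; pose f (x : W) : 'I_n.+1 := inord (index x s).
have fE x : f x = index x s :> nat by rewrite inordK // -sz index_mem.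
exists f; split; last first.
  by move=> x y; rewrite /path_rel !fE -H -?sz ?index_mem // !nth_index.
exists (fun i : 'I_n.+1 => nth x0 s i) => [x|i]; first by rewrite fE nth_index.
by apply: val_inj; rewrite /= fE index_uniq ?sz.
Qed.

Section ShortPath.
Variables (W : finType) (e : rel W).
Hypotheses (S : simple_graph e) (cW : connected_graph e) (n1 : 2 < #|W|).

(** The neighbour [a] of the leaf [l] has degree 2, as there are more than two vertices. The next
    vertex [b] is a leaf, giving [path_rel 2], or has degree 2 and a leaf neighbour, which completes
    [path_rel 3]. *)
Lemma short_path l : deg e l = 1 -> (forall b, deg e b <= 2) ->
  (forall u, deg e u = 2 -> exists2 m, e u m & deg e m = 1) ->
  graph_iso e (path_rel 2) \/ graph_iso e (path_rel 3).
Proof.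
move=> dl d2 nl; have [se re] := S.
have [a la] := deg1P dl; have ea : e a l by rewrite se la eqxx.
have cl (X : {set W}) : l \in X -> (forall x y, x \in X -> e x y -> y \in X) -> forall x, x \in X.
  by move=> lX clX x; rewrite (all_closed cW lX clX) inE.
have neq x y : e x y -> x != y by apply: contraTneq => ->; rewrite re.
have d2' x : deg e x != 1 -> deg e x = 2.
  by move=> dx; move: (d2 x) (deg_pos cW n1 x); case: (deg e x) dx => [|[|[|]]].
have [da|/d2' da] := eqVneq (deg e a) 1.
  have [t at1] := deg1P da; have tl : t = l by move: ea; rewrite at1 => /eqP.
  have [z zl za] := third_element l a n1.
  have : z \in [set l; a].
    apply: cl; first by rewrite !inE eqxx.
    move=> x y; rewrite !inE => /orP[] /eqP->; rewrite ?la ?at1 ?tl => /eqP->; rewrite eqxx ?orbT //.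
  by rewrite !inE (negPf zl) (negPf za).
have [b bl aN] := deg2P da ea.
have ab : e a b by rewrite aN eqxx orbT.
have abn := neq _ _ ab.
have E1 : (a == l = false) * (l == a = false) by rewrite (eq_sym l) (negPf (neq _ _ ea)).
have E2 : (b == a = false) * (a == b = false) by rewrite (eq_sym b) (negPf abn).
have E3 : (b == l = false) * (l == b = false) by rewrite (eq_sym l) (negPf bl).
have [db|/d2' db] := eqVneq (deg e b) 1.
  have [t bt] := deg1P db; have ta : t = a by apply/esym/eqP; rewrite -bt se.
  left; apply: (@path_iso _ _ l [:: l; a; b]) => //.
  - by rewrite /= !inE E1 E2 E3.
  - move=> x; suff : x \in [set l; a; b] by rewrite !inE -orbA.
    apply: cl; first by rewrite !inE eqxx.
    move=> u y; rewrite !inE -!orbA => /or3P[] /eqP->; rewrite ?la ?aN ?bt ?ta.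
    + by move/eqP->; rewrite eqxx orbT.
    + by case/orP=> /eqP->; rewrite eqxx ?orbT.
    by move/eqP->; rewrite eqxx orbT.
  case=> [|[|[|i]]] [|[|[|j]]] //= _ _; rewrite ?la ?aN ?bt ?ta ?eqxx ?E1 ?E2 ?E3 ?orbT //.
have [m bm dm] := nl b db.
have ba : e b a by rewrite se.
have [c ca bN] := deg2P db ba.
have ma : m != a by apply: contraPneq dm => ->; rewrite da.
have mc : m = c by move: bm; rewrite bN (negPf ma) => /eqP.
subst m; have [t ct] := deg1P dm.
have tb : t = b by apply/esym/eqP; rewrite -ct se.
have bc := neq _ _ bm.
have cl' : c != l by apply: contraTneq bm => ->; rewrite se la E2.
have E4 : (c == l = false) * (l == c = false) by rewrite (eq_sym l) (negPf cl').
have E5 : (c == a = false) * (a == c = false) by rewrite (eq_sym a) (negPf ca).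
have E6 : (c == b = false) * (b == c = false) by rewrite (eq_sym c) (negPf bc).
right; apply: (@path_iso _ _ l [:: l; a; b; c]) => //.
- by rewrite /= !inE E1 E2 E3 E4 E5 E6.
- move=> x; suff : x \in [set l; a; b; c] by rewrite !inE -!orbA.
  apply: cl; first by rewrite !inE eqxx.
  move=> u y; rewrite !inE -!orbA => /or4P[] /eqP->; rewrite ?la ?aN ?bN ?ct ?tb.
  + by move/eqP->; rewrite eqxx orbT.
  + by case/orP=> /eqP->; rewrite eqxx ?orbT.
  + by case/orP=> /eqP->; rewrite eqxx ?orbT.
  by move/eqP->; rewrite eqxx ?orbT.
case=> [|[|[|[|i]]]] [|[|[|[|j]]]] //= _ _; rewrite ?la ?aN ?bN ?ct ?tb ?eqxx ?E1 ?E2 ?E3 ?E4 ?E5 ?E6 ?orbT //.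
Qed.
End ShortPath.

(** * Case distinction on the order of the smaller graph *)

Lemma graph_iso_sym (V W : finType) (eV : rel V) (eW : rel W) :
  graph_iso eV eW -> graph_iso eW eV.
Proof.
case=> f [[g fK gK] hf]; exists g; split; first by exists f.
by move=> x y; rewrite -hf !gK.
Qed.

Lemma graph_iso_trans (U V W : finType) (eU : rel U) (eV : rel V) (eW : rel W) :
  graph_iso eU eV -> graph_iso eV eW -> graph_iso eU eW.
Proof.
case=> f [bf hf] [g [bg hg]]; exists (g \o f); split; first exact: bij_comp.
by move=> x y; rewrite /= hg hf.
Qed.

Lemma two_vertex_path (W : finType) (e : rel W) : simple_graph e -> connected_graph e ->
  #|W| = 2 -> graph_iso e (path_rel 1).
Proof.
move=> [se re] cW n2; have /card_gt0P[v _] : 0 < #|W| by rewrite n2.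
have [|u uv E] := @setU1_two _ [set: W] v (in_setT v); first by rewrite cardsT.
have vu : v != u by rewrite eq_sym.
have inE' x : (x == v) || (x == u) by have := in_setT x; rewrite E !inE.
have [b _ /andP[bv vb]] := conn_nbr (connected_conn cW) (in_setT v) (in_setT u) vu.
have bu : b = u by have := inE' b; rewrite (negPf bv) => /eqP.
subst b; apply: (@path_iso _ _ v [:: v; u]) => //.
- by rewrite /= inE vu.
- by move=> x; rewrite !inE.
by case=> [|[|i]] [|[|j]] //= _ _; rewrite ?re // se.
Qed.

(** If attaching an edge always fails, every vertex of maximal degree has a leaf neighbour. So a
    leaf exists, which rules out degrees above 2 by the farthest-leaf construction, and [short_path]
    applies. *)
Lemma edge_composable (W1 W2 : finType) (e1 : rel W1) (e2 : rel W2) :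
  simple_graph e1 -> simple_graph e2 -> connected_graph e1 -> connected_graph e2 ->
  2 < #|W1| -> #|W2| = 2 ->
  ~ graph_iso e1 (path_rel 2) -> ~ graph_iso e1 (path_rel 3) -> composable e1 e2.
Proof.
move=> S1 S2 c1 c2 n1 n2 np2 np3.
have far := far_leaf_composable S1 S2 c1 c2 n1 n2; have mx := max_deg_composable S1 S2 c1 c2 n1 n2.
have [u0 _] := card_gt0P (ltn_trans (isT : 0 < 2) n1).
have [u _ mu] := @arg_maxnP _ u0 xpredT (deg e1) isT.
have {}mu b : deg e1 b <= deg e1 u by apply: mu.
apply: NNPP => ns.
have nl v : deg e1 v = deg e1 u -> exists2 l, e1 v l & deg e1 l = 1.
  move=> dv; apply: NNPP => no; apply/ns/(mx v); first by move=> b; rewrite dv.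
  by move=> l lv; apply/eqP => dl; apply: no; exists l; rewrite // S1.1.
have [l _ dl] := nl u erefl.
have d2 b : deg e1 b <= 2.
  by rewrite leqNgt; apply/negP => db; apply: ns; apply: far dl db.
(* With maximal degree 1, a leaf and its neighbour would already be all of [e1]. *)
have du : deg e1 u = 2.
  apply/eqP; rewrite eqn_leq d2 ltnNge; apply/negP => du.
  have d1 v : deg e1 v = 1.
    by apply/eqP; rewrite eqn_leq (leq_trans (mu v) du) (deg_pos c1 n1).
  have [t lt] := deg1P (d1 l); have [s ts] := deg1P (d1 t).
  have sl : s = l by apply/esym/eqP; rewrite -ts S1.1 lt.
  have [z zl zt] := third_element l t n1.
  have E : [set l; t] = setT.
    apply: (all_closed c1 (a := l)); first by rewrite !inE eqxx.
    by move=> x y; rewrite !inE => /orP[] /eqP->; rewrite ?lt ?ts ?sl => ->; rewrite ?orbT.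
  by have := in_setT z; rewrite -E !inE (negPf zl) (negPf zt).
have [|//|//] := short_path S1 c1 n1 dl d2.
by move=> v dv; apply: nl; rewrite du.
Qed.

(** The pair [(p, q)] and its reversal each yield a pendant copy, one containing [p] and one
    containing [q], as [thick_composable] requires. *)
Lemma large_composable (W1 W2 : finType) (e1 : rel W1) (e2 : rel W2) :
  simple_graph e1 -> simple_graph e2 -> connected_graph e1 -> connected_graph e2 ->
  2 < #|W2| -> #|W2| <= #|W1| -> ~ graph_iso e1 e2 -> composable e1 e2.
Proof.
move=> S1 S2 c1 c2 n2 n21 ni; apply: NNPP => ns.
have [D [p [q [h [h' [dq dp]]]]]] := diametral_exists S1.1 c1.
have n2' : 1 < #|W2| by apply: ltnW.
have nc := end_sum_no_cut S1 S2 c1 c2 n21 n2' ni ns dq.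
have /card_gt0P[v _] : 0 < #|W2| by apply: ltnW.
have [w' [k' [Pp _]]] := end_sum_pendant S1 S2 c1 c2 n21 n2' ni ns v dq.
have [w [k [Pq _]]] := end_sum_pendant S1 S2 c1 c2 n21 n2' ni ns v dp.
apply: ns; exact: (thick_composable S1 S2 c1 c2 n2 nc dq Pq Pp).
Qed.

Lemma ordered_composable (W1 W2 : finType) (e1 : rel W1) (e2 : rel W2) :
  simple_graph e1 -> simple_graph e2 -> connected_graph e1 -> connected_graph e2 ->
  1 < #|W2| -> #|W2| <= #|W1| -> ~ graph_iso e1 e2 ->
  ~ (graph_iso e1 (path_rel 2) /\ graph_iso e2 (path_rel 1)) ->
  ~ (graph_iso e1 (path_rel 3) /\ graph_iso e2 (path_rel 1)) -> composable e1 e2.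
Proof.
move=> S1 S2 c1 c2 n2 n21 ni np2 np3.
have [n2'|n2'] := ltnP 2 #|W2|; first exact: large_composable.
have {}n2' : #|W2| = 2 by apply/eqP; rewrite eqn_leq n2' n2.
have i2 := two_vertex_path S2 c2 n2'.
have [n1|n1] := ltnP 2 #|W1|.
  by apply: edge_composable => // i1; [apply: np2|apply: np3].
have n1' : #|W1| = 2 by apply/eqP; rewrite eqn_leq n1 -n2'.
by case: ni; apply: graph_iso_trans (two_vertex_path S1 c1 n1') (graph_iso_sym i2).
Qed.

Theorem mainTheorem7 (W1 W2 : finType) (e1 : rel W1) (e2 : rel W2) :
  simple_graph e1 -> simple_graph e2 ->
  connected_graph e1 -> connected_graph e2 ->
  1 < #|W1| -> 1 < #|W2| ->
  ~ graph_iso e1 e2 ->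
  ~ ((graph_iso e1 (path_rel 1) /\ graph_iso e2 (path_rel 2)) \/
     (graph_iso e1 (path_rel 2) /\ graph_iso e2 (path_rel 1))) ->
  ~ ((graph_iso e1 (path_rel 1) /\ graph_iso e2 (path_rel 3)) \/
     (graph_iso e1 (path_rel 3) /\ graph_iso e2 (path_rel 1))) ->
  exists (V : finType) (e : rel V),
    [/\ simple_graph e, connected_graph e,
        ~ graph_iso e e1, ~ graph_iso e e2 &
        uniquely_decomposable e e1 e2].
Proof.
move=> S1 S2 c1 c2 n1 n2 ni np2 np3.
suff [V [e [Se ce nV U]]] : composable e1 e2.
  move: nV; rewrite gtn_max => /andP[nV1 nV2].
  by exists V, e; split=> // /graph_iso_card E; rewrite E ltnn in nV1 nV2.
(* Unique decomposability is symmetric in the summands, so the larger one may be taken first. *)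
have [n21|/ltnW n12] := leqP #|W2| #|W1|.
  by apply: ordered_composable => // i; [apply: np2|apply: np3]; right.
have [|||V [e [Se ce nV U]]] := ordered_composable S2 S1 c2 c1 n1 n12.
- by move/graph_iso_sym.
- by case=> i1 i2; apply: np2; left.
- by case=> i1 i2; apply: np3; left.
by exists V, e; split=> //; [rewrite maxnC | apply: uniquely_decomposableC].
Qed.
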